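(* Let $R\subseteq\{e,c\}$. The provability problems for $\mathbf{NACCLL}^-_R$ and for $\mathbf{NACCLL}_R$ are undecidable: there is no algorithm deciding, for an arbitrary sequent $s$, whether $s$ is provable in $\mathbf{NACCLL}^-_R$ (resp. $\mathbf{NACCLL}_R$).
   Context: Formulas: terms over a countably infinite set of variables in $\{\wedge,\vee,\cdot,\backslash,/,!,1,0\}$. Structures: elements of the free unital groupoid $(Fm^\circ,\circ,\varepsilon)$ generated by formulas ($\circ$ non-associative, $\varepsilon$ empty structure and unit). $k$ ranges over structures in the free unital groupoid generated by formulas $!a$ (including $\varepsilon$). A context $u$ is a structure with exactly one hole; $u(x)$ fills it. A sequent is $x\Rightarrow\delta$, $\delta$ a formula or the empty stoup $\epsilon$. $\mathbf{NACILL}^0$: initial sequents $a\Rightarrow a$, $\varepsilon\Rightarrow 1$, $0\Rightarrow\epsilon$; rules (premises / conclusion): (cut) $x\Rightarrow a$, $u(a)\Rightarrow\delta$ / $u(x)\Rightarrow\delta$; $(1\Rightarrow)$ $u(\varepsilon)\Rightarrow\delta$ / $u(1)\Rightarrow\delta$; $(\Rightarrow 0)$ $x\Rightarrow\epsilon$ / $x\Rightarrow 0$; $(\backslash\Rightarrow)$ $x\Rightarrow a$, $u(b)\Rightarrow\delta$ / $u(x\circ(a\backslash b))\Rightarrow\delta$; $(\Rightarrow\backslash)$ $a\circ x\Rightarrow b$ / $x\Rightarrow a\backslash b$; $(/\Rightarrow)$ $x\Rightarrow a$, $u(b)\Rightarrow\delta$ / $u((b/a)\circ x)\Rightarrow\delta$;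 $(\Rightarrow/)$ $x\circ a\Rightarrow b$ / $x\Rightarrow b/a$; $(\cdot\Rightarrow)$ $u(a\circ b)\Rightarrow\delta$ / $u(a\cdot b)\Rightarrow\delta$; $(\Rightarrow\cdot)$ $x\Rightarrow a$, $y\Rightarrow b$ / $x\circ y\Rightarrow a\cdot b$; $(\wedge\Rightarrow)$ $u(a_i)\Rightarrow\delta$ / $u(a_1\wedge a_2)\Rightarrow\delta$; $(\Rightarrow\wedge)$ $x\Rightarrow a$, $x\Rightarrow b$ / $x\Rightarrow a\wedge b$; $(\vee\Rightarrow)$ $u(a)\Rightarrow\delta$, $u(b)\Rightarrow\delta$ / $u(a\vee b)\Rightarrow\delta$; $(\Rightarrow\vee)$ $x\Rightarrow a_i$ / $x\Rightarrow a_1\vee a_2$; $(!\Rightarrow)$ $u(a)\Rightarrow\delta$ / $u(!a)\Rightarrow\delta$; $(\Rightarrow!)$ $k\Rightarrow a$ / $k\Rightarrow !a$; $(kw)$ $u(\varepsilon)\Rightarrow\delta$ / $u(k)\Rightarrow\delta$; $(kc)$ $u(k\circ k)\Rightarrow\delta$ / $u(k)\Rightarrow\delta$; two-directional: $(ke)$ $u(k\circ y)\Rightarrow\delta\leftrightarrow u(y\circ k)\Rightarrow\delta$; $(ka1)$ $u((k\circ y)\circ z)\Rightarrow\delta\leftrightarrow u(k\circ(y\circ z))\Rightarrow\delta$; $(ka2)$ $u((x\circ y)\circ k)\Rightarrow\delta\leftrightarrow u(x\circ(y\circ k))\Rightarrow\delta$. $\mathbf{NACCLL}^-$: $\mathbf{NACILL}^0$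 plus initial sequents ${\sim}(-a)\Rightarrow a$, $-({\sim}a)\Rightarrow a$, $({\sim}a)/b\Rightarrow a\backslash(-b)$, $a\backslash(-b)\Rightarrow({\sim}a)/b$, where ${\sim}a:=a\backslash 0$, $-a:=0/a$. $\mathbf{NACCLL}$: additionally ${\sim}a\Rightarrow -a$ and $-a\Rightarrow{\sim}a$. Structural rules: $(e)$ $u(x\circ y)\Rightarrow\delta$ / $u(y\circ x)\Rightarrow\delta$; $(c)$ $u(x\circ x)\Rightarrow\delta$ / $u(x)\Rightarrow\delta$. Subscript $R$ adds the rules in $R$. A sequent is provable if it has a derivation whose leaves are initial sequents. *)

(* Defs.v *)
From Stdlib Require Import List Arith.
Import ListNotations.

Inductive fm : Type :=
| Var  (n : nat)
| And  (a b : fm)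
| Or   (a b : fm)
| Mul  (a b : fm)
| Ldiv (a b : fm)
| Rdiv (b a : fm)
| Bang (a : fm)
| One
| Zero.

Definition tneg (a : fm) : fm := Ldiv a Zero.
Definition mneg (a : fm) : fm := Rdiv Zero a.

(* ---------- Structures: the free unital groupoid over formulas ----------
   Non-empty structures are binary trees with formula leaves; the empty
   structure epsilon is None.  Composition is non-associative, with epsilon
   as a two-sided unit; every element of the free unital groupoid has a
   unique representation in [str]. *)
Inductive nstr : Type :=
| NF (a : fm)
| NC (x y : nstr).

Definition str : Type := option nstr.

Definition comp (x y : str) : str :=
  match x, y with
  | None, _ => y
  | _, None => x
  | Some x', Some y' => Some (NC x' y')
  end.

Definition sf (a : fm) : str := Some (NF a).

Inductive ctx : Type :=
| Hole
| CL (u : ctx) (y : str)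
| CR (y : str) (u : ctx).

Fixpoint fill (u : ctx) (x : str) : str :=
  match u with
  | Hole => x
  | CL u y => comp (fill u x) y
  | CR y u => comp y (fill u x)
  end.

Fixpoint kstrn (t : nstr) : Prop :=
  match t with
  | NF (Bang _) => True
  | NF _ => False
  | NC x y => kstrn x /\ kstrn y
  end.

Definition kstr (x : str) : Prop :=
  match x with None => True | Some t => kstrn t end.

Definition stoup : Type := option fm.

(* ---------- The calculi ----------
   prov full e c x d :  x => d  is provable in
     NACCLL^-_R  if full = false,   NACCLL_R  if full = true,
   where R contains (e) iff e = true and (c) iff c = true. *)
Inductive prov (full e c : bool) : str -> stoup -> Prop :=
| ax_id a : prov full e c (sf a) (Some a)
| ax_one : prov full e c None (Some One)
| ax_zero : prov full e c (sf Zero) None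
| ax_nn1 a : prov full e c (sf (tneg (mneg a))) (Some a)
| ax_nn2 a : prov full e c (sf (mneg (tneg a))) (Some a)
| ax_cp1 a b : prov full e c (sf (Rdiv (tneg a) b)) (Some (Ldiv a (mneg b)))
| ax_cp2 a b : prov full e c (sf (Ldiv a (mneg b))) (Some (Rdiv (tneg a) b))
| ax_f1 a : full = true -> prov full e c (sf (tneg a)) (Some (mneg a))
| ax_f2 a : full = true -> prov full e c (sf (mneg a)) (Some (tneg a))
| r_cut x a u d :
    prov full e c x (Some a) -> prov full e c (fill u (sf a)) d ->
    prov full e c (fill u x) d
| r_oneL u d :
    prov full e c (fill u None) d -> prov full e c (fill u (sf One)) d
| r_zeroR x :
    prov full e c x None -> prov full e c x (Some Zero)
| r_ldivL x a b u d :
    prov full e c x (Some a) -> prov full e c (fill u (sf b)) d ->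
    prov full e c (fill u (comp x (sf (Ldiv a b)))) d
| r_ldivR x a b :
    prov full e c (comp (sf a) x) (Some b) -> prov full e c x (Some (Ldiv a b))
| r_rdivL x a b u d :
    prov full e c x (Some a) -> prov full e c (fill u (sf b)) d ->
    prov full e c (fill u (comp (sf (Rdiv b a)) x)) d
| r_rdivR x a b :
    prov full e c (comp x (sf a)) (Some b) -> prov full e c x (Some (Rdiv b a))
| r_mulL u a b d :
    prov full e c (fill u (comp (sf a) (sf b))) d ->
    prov full e c (fill u (sf (Mul a b))) d
| r_mulR x y a b :
    prov full e c x (Some a) -> prov full e c y (Some b) ->
    prov full e c (comp x y) (Some (Mul a b))
| r_andL1 u a b d :
    prov full e c (fill u (sf a)) d -> prov full e c (fill u (sf (And a b))) d
| r_andL2 u a b d :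
    prov full e c (fill u (sf b)) d -> prov full e c (fill u (sf (And a b))) d
| r_andR x a b :
    prov full e c x (Some a) -> prov full e c x (Some b) ->
    prov full e c x (Some (And a b))
| r_orL u a b d :
    prov full e c (fill u (sf a)) d -> prov full e c (fill u (sf b)) d ->
    prov full e c (fill u (sf (Or a b))) d
| r_orR1 x a b :
    prov full e c x (Some a) -> prov full e c x (Some (Or a b))
| r_orR2 x a b :
    prov full e c x (Some b) -> prov full e c x (Some (Or a b))
| r_bangL u a d :
    prov full e c (fill u (sf a)) d -> prov full e c (fill u (sf (Bang a))) d
| r_bangR k a :
    kstr k -> prov full e c k (Some a) -> prov full e c k (Some (Bang a))
| r_kw u k d :
    kstr k -> prov full e c (fill u None) d -> prov full e c (fill u k) d
| r_kc u k d :
    kstr k -> prov full e c (fill u (comp k k)) d -> prov full e c (fill u k) d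
| r_ke1 u k y d :
    kstr k -> prov full e c (fill u (comp k y)) d ->
    prov full e c (fill u (comp y k)) d
| r_ke2 u k y d :
    kstr k -> prov full e c (fill u (comp y k)) d ->
    prov full e c (fill u (comp k y)) d
| r_ka1a u k y z d :
    kstr k -> prov full e c (fill u (comp (comp k y) z)) d ->
    prov full e c (fill u (comp k (comp y z))) d
| r_ka1b u k y z d :
    kstr k -> prov full e c (fill u (comp k (comp y z))) d ->
    prov full e c (fill u (comp (comp k y) z)) d
| r_ka2a u k x y d :
    kstr k -> prov full e c (fill u (comp (comp x y) k)) d ->
    prov full e c (fill u (comp x (comp y k))) d
| r_ka2b u k x y d :
    kstr k -> prov full e c (fill u (comp x (comp y k))) d ->
    prov full e c (fill u (comp (comp x y) k)) d
| r_e u x y d :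
    e = true -> prov full e c (fill u (comp x y)) d ->
    prov full e c (fill u (comp y x)) d
| r_c u x d :
    c = true -> prov full e c (fill u (comp x x)) d ->
    prov full e c (fill u x) d.

Definition cpair (a b : nat) : nat := (a + b) * (a + b + 1) / 2 + b.

Fixpoint enc_fm (a : fm) : nat :=
  match a with
  | Var n => cpair 0 n
  | And a b => cpair 1 (cpair (enc_fm a) (enc_fm b))
  | Or a b => cpair 2 (cpair (enc_fm a) (enc_fm b))
  | Mul a b => cpair 3 (cpair (enc_fm a) (enc_fm b))
  | Ldiv a b => cpair 4 (cpair (enc_fm a) (enc_fm b))
  | Rdiv b a => cpair 5 (cpair (enc_fm b) (enc_fm a))
  | Bang a => cpair 6 (enc_fm a)
  | One => cpair 7 0
  | Zero => cpair 8 0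
  end.

Fixpoint enc_nstr (t : nstr) : nat :=
  match t with
  | NF a => cpair 0 (enc_fm a)
  | NC x y => cpair 1 (cpair (enc_nstr x) (enc_nstr y))
  end.

Definition enc_str (x : str) : nat :=
  match x with None => 0 | Some t => S (enc_nstr t) end.

Definition enc_stoup (d : stoup) : nat :=
  match d with None => 0 | Some a => S (enc_fm a) end.

Definition enc_seq (x : str) (d : stoup) : nat := cpair (enc_str x) (enc_stoup d).

(* ---------- Model of computation: (partial) mu-recursive functions ----------
   Arguments are lists of naturals; missing arguments default to 0. *)
Inductive recf : Type :=
| RZ
| RS
| RP (i : nat)
| RC (f : recf) (gs : list recf)
| RR (f g : recf)
| RM (f : recf).

Inductive evalr : recf -> list nat -> nat -> Prop :=
| ev_z v : evalr RZ v 0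
| ev_s v : evalr RS v (S (hd 0 v))
| ev_p i v : evalr (RP i) v (nth i v 0)
| ev_c f gs v ws y :
    Forall2 (fun g w => evalr g v w) gs ws -> evalr f ws y -> evalr (RC f gs) v y
| ev_r0 f g v y : evalr f v y -> evalr (RR f g) (0 :: v) y
| ev_rS f g n v z y :
    evalr (RR f g) (n :: v) z -> evalr g (n :: z :: v) y ->
    evalr (RR f g) (S n :: v) y
| ev_m f v n :
    evalr f (n :: v) 0 ->
    (forall m, m < n -> exists k, evalr f (m :: v) (S k)) ->
    evalr (RM f) v n.

Definition decides (f : recf) (P : str -> stoup -> Prop) : Prop :=
  forall x d, exists b, evalr f [enc_seq x d] b /\ (b = 0 <-> P x d).

Definition seq_decidable (P : str -> stoup -> Prop) : Prop :=
  exists f, decides f P.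

(* Main.v *)
Require Import Defs.
From Stdlib Require Import List Arith Lia Classical FunctionalExtensionality
  PropExtensionality Permutation Cantor.
Import ListNotations.

(** Composing a decider with the map A |-> sequent (A o num (code of A) =>) gives a partial recursive
    function G, so it is enough to find for every G a formula A such that, in each of the calculi,
    A o num m => is provable iff G m is defined and nonzero; taking m to be the code of A is then
    contradictory. No universal machine is needed.

    The graph of G is verified by an alternating counter machine: intermediate values are guessed, and
    universal branching replaces copying, since each computation branch may destroy all registers. A
    configuration is a tree whose components are stacks with a state at the innermost leaf. A
    transition axiom !(s \ (s' v chk)) acts on one component only; the disjunct chk opens a second
    subderivation, in which the stacks are erased and the states of all other components are compared
    with the guard of the rule. Disjunction thus synchronises the components, although the calculus is
    not associative.

    Provability of accepting configurations is shown in the weakest calculus, and the converse in the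
    strongest one, by a phase model. Its pole consists of unrooted trees, i.e. it is invariant under
    moving the root, which gives the involutive axioms. Accepted trees contain no subtree x o x, so
    contraction holds vacuously. *)

(** * Phase semantics *)

(** The product itself need be neither commutative nor associative; only membership in the pole is
    invariant. [pole_assoc] regroups three factors at the root, which moves the root of the tree to
    a neighbouring edge. Iterated, it brings any inner node next to the root, where [pole_comm3]
    swaps its children. *)
Record phase := {
  pt :> Type;
  un : pt;
  mul : pt -> pt -> pt;
  pole : pt -> Prop;
  mul_unl : forall x, mul un x = x;
  mul_unr : forall x, mul x un = x;
  pole_comm : forall x y, pole (mul x y) -> pole (mul y x);
  pole_comm3 : forall x y z, pole (mul (mul x y) z) -> pole (mul (mul y x) z);
  pole_assoc : forall x y z, pole (mul (mul x y) z) -> pole (mul x (mul y z));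
  pole_contr : forall x z, pole (mul (mul x x) z) -> pole (mul x z)
}.

Section Phase.
Variable M : phase.
Local Notation "x ** y" := (mul M x y) (at level 40, left associativity).
Local Notation set := (M -> Prop).

Definition orth (X : set) : set := fun y => forall x, X x -> pole M (x ** y).
Definition subset (X Y : set) : Prop := forall x, X x -> Y x.
Definition tens (X Y : set) : set :=
  orth (fun w => forall x y, X x -> Y y -> pole M (x ** y ** w)).
Definition imp (X Y : set) : set :=
  fun w => forall x y, X x -> orth Y y -> pole M (x ** w ** y).
Definition cl (x : M) : set := orth (orth (fun y => y = x)).
Definition join (X Y : set) : set := orth (orth (fun z => X z \/ Y z)).
(* [bang X] is the unit if [X] contains it, and [bot] otherwise; so every [k]
   denotes the unit or [bot]. *)
Definition bang (X : set) : set := orth (orth (fun z => z = un M /\ X z)).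
Definition bot : set := orth (orth (fun _ => False)).

Definition closed (X : set) : Prop := orth (orth X) = X.

Lemma set_eq (X Y : set) : subset X Y -> subset Y X -> X = Y.
Proof.
  intros H1 H2. apply functional_extensionality. intro x.
  apply propositional_extensionality. split; [apply H1 | apply H2].
Qed.

Lemma pole_rot x y z : pole M (x ** y ** z) -> pole M (y ** z ** x).
Proof. intro H. now apply pole_comm, pole_assoc. Qed.

Lemma pole_swap x y z : pole M (x ** y ** z) -> pole M (x ** z ** y).
Proof. intro H. now apply pole_rot, pole_comm3. Qed.

Lemma orth_anti X Y : subset X Y -> subset (orth Y) (orth X).
Proof. intros H y Hy x Hx. apply Hy, H, Hx. Qed.

Lemma orth_orth X : subset X (orth (orth X)).
Proof. intros x Hx y Hy. apply pole_comm, Hy, Hx. Qed.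

Lemma orth_closed X : closed (orth X).
Proof.
  apply set_eq; [apply orth_anti, orth_orth | apply orth_orth].
Qed.

Lemma imp_orth X Y : imp X Y = orth (tens X (orth Y)).
Proof.
  apply set_eq.
  - intros w Hw.
    apply (orth_orth (fun w => forall x y, X x -> orth Y y -> pole M (x ** y ** w))).
    intros x y Hx Hy. now apply pole_swap, Hw.
  - intros w Hw x y Hx Hy. apply pole_swap, Hw. intros z Hz. now apply pole_comm, Hz.
Qed.

Lemma closed_imp X Y : closed (imp X Y).
Proof. rewrite imp_orth. apply orth_closed. Qed.

Lemma closed_meet X Y : closed X -> closed Y -> closed (fun x => X x /\ Y x).
Proof.
  intros HX HY. apply set_eq; [| apply orth_orth].
  intros x Hx. split; [rewrite <- HX | rewrite <- HY];
    (eapply orth_anti; [| apply Hx]; apply orth_anti; intros y [H1 H2]; trivial).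
Qed.

Lemma closed_incl X Y : closed Y -> subset X Y -> subset (orth (orth X)) Y.
Proof. intros HY H. rewrite <- HY. now do 2 apply orth_anti. Qed.

Lemma cl_incl x Y : closed Y -> Y x -> subset (cl x) Y.
Proof. intros HY H. apply closed_incl; trivial. now intros ? ->. Qed.

Lemma cl_self x : cl x x.
Proof. now apply orth_orth. Qed.

Lemma orth_un : orth (cl (un M)) = pole M.
Proof.
  unfold cl. rewrite (orth_closed (fun y => y = un M)). apply set_eq.
  - intros x Hx. rewrite <- (mul_unl M x). now apply Hx.
  - intros x Hx y ->. now rewrite mul_unl.
Qed.

Lemma closed_pole : closed (pole M).
Proof. rewrite <- orth_un. apply orth_closed. Qed.

Lemma orth_pole : orth (pole M) = cl (un M).
Proof. rewrite <- orth_un. apply orth_closed. Qed.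

Lemma tens_spec X Y Z : closed Z ->
  (forall x y, X x -> Y y -> Z (x ** y)) -> subset (tens X Y) Z.
Proof.
  intros HZ H z Hz. rewrite <- HZ. intros w Hw. apply Hz.
  intros x y Hx Hy. apply pole_comm. apply pole_comm, Hw, H; trivial.
Qed.

Lemma tens_in X Y x y : X x -> Y y -> tens X Y (x ** y).
Proof. intros Hx Hy w Hw. apply pole_comm. now apply Hw. Qed.

Lemma closed_tens X Y : closed (tens X Y).
Proof. apply orth_closed. Qed.

Lemma tens_mono X Y X' Y' : subset X X' -> subset Y Y' -> subset (tens X Y) (tens X' Y').
Proof.
  intros H1 H2. apply tens_spec; [apply closed_tens |].
  intros; apply tens_in; auto.
Qed.

Lemma tens_adj X Y Z : closed Z -> (subset (tens X Y) Z <-> subset Y (imp X Z)).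
Proof.
  intros HZ. split; intro H.
  - intros y Hy x z Hx Hz. apply pole_comm. apply pole_comm, Hz. now apply H, tens_in.
  - apply tens_spec; trivial. intros x y Hx Hy. rewrite <- HZ.
    intros z Hz. apply pole_comm. now apply H.
Qed.

Lemma tens_comm X Y : tens X Y = tens Y X.
Proof.
  assert (H : forall X Y, subset (tens X Y) (tens Y X)).
  { intros A B. apply tens_spec; [apply closed_tens |]. intros x y Hx Hy w Hw.
    apply pole_comm, pole_comm3. now apply Hw. }
  apply set_eq; apply H.
Qed.

Lemma tens_un X : closed X -> tens (cl (un M)) X = X.
Proof.
  intro HX. apply set_eq.
  - apply tens_adj; trivial. intros x Hx y z Hy Hz.
    assert (K : orth (cl (un M)) (x ** z)) by (rewrite orth_un; now apply Hz).
    now apply pole_rot, pole_rot, pole_comm, K.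
  - intros x Hx. rewrite <- (mul_unl M x). apply tens_in; trivial. apply cl_self.
Qed.

Lemma tens_un_r X : closed X -> tens X (cl (un M)) = X.
Proof. intro H. rewrite tens_comm. now apply tens_un. Qed.

Lemma bot_incl X : closed X -> subset bot X.
Proof. intro H. apply closed_incl; trivial. now intros x []. Qed.

Lemma tens_bot X : tens bot X = bot.
Proof.
  apply set_eq; [| apply bot_incl, closed_tens].
  rewrite tens_comm. apply tens_adj; [apply orth_closed |].
  apply bot_incl, closed_imp.
Qed.

(** By [pole_contr], a test point that passes on all products of two elements of [X] also passes on
    each single element. *)
Lemma tens_contr X : subset X (tens X X).
Proof.
  intros x Hx w Hw. apply pole_comm, pole_contr. now apply Hw.
Qed.

(** Principal closed sets multiply like their generators, so the value of a product of variables is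
    computed in the underlying groupoid. *)
Lemma tens_cl x y : tens (cl x) (cl y) = cl (x ** y).
Proof.
  apply set_eq.
  - apply tens_adj; [apply orth_closed |]. apply cl_incl; [apply closed_imp |].
    assert (H : subset (cl x) (imp (fun a => a = y) (cl (x ** y)))).
    { apply cl_incl; [apply closed_imp |]. intros a z -> Hz.
      apply pole_comm3. apply Hz, cl_self. }
    intros a z Ha Hz. apply pole_comm3. now apply (H a Ha y z).
  - apply cl_incl; [apply closed_tens |]. apply tens_in; apply cl_self.
Qed.

(** * Interpretation of formulas and soundness *)

Variable v : nat -> M.

(** Both divisions receive the same value, since the pole does not see the order of factors. *)
Fixpoint val (a : fm) : set :=
  match a with
  | Var n => cl (v n)
  | And a b => fun x => val a x /\ val b x
  | Or a b => join (val a) (val b)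
  | Mul a b => tens (val a) (val b)
  | Ldiv a b => imp (val a) (val b)
  | Rdiv b a => imp (val a) (val b)
  | Bang a => bang (val a)
  | One => cl (un M)
  | Zero => pole M
  end.

Lemma val_closed a : closed (val a).
Proof.
  induction a; simpl; try apply orth_closed; try apply closed_imp.
  - now apply closed_meet.
  - apply closed_pole.
Qed.

Fixpoint valn (t : nstr) : set :=
  match t with NF a => val a | NC x y => tens (valn x) (valn y) end.

Definition vals (x : str) : set :=
  match x with None => cl (un M) | Some t => valn t end.

Definition vald (d : stoup) : set :=
  match d with None => pole M | Some a => val a end.

Lemma vals_closed x : closed (vals x).
Proof.
  destruct x as [[a | x y] |]; simpl; [apply val_closed | apply closed_tens | apply orth_closed].
Qed.

Lemma vald_closed d : closed (vald d).
Proof. destruct d; [apply val_closed | apply closed_pole]. Qed.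

Lemma vals_comp x y : vals (comp x y) = tens (vals x) (vals y).
Proof.
  destruct x as [x |].
  - destruct y as [y |]; [reflexivity |]. symmetry. apply tens_un_r, vals_closed.
  - symmetry. apply tens_un, vals_closed.
Qed.

(** Residuation peels off the context layer by layer. Every rule acting inside a context thereby
    reduces to an inclusion between values at the hole. *)
Lemma fill_adj u d : exists Z, closed Z /\
  forall x, subset (vals (fill u x)) (vald d) <-> subset (vals x) Z.
Proof.
  assert (H : forall Y, closed Y -> exists Z, closed Z /\
    forall x, subset (vals (fill u x)) Y <-> subset (vals x) Z).
  { induction u; simpl; intros Y HY.
    - exists Y. now split.
    - destruct (IHu (imp (vals y) Y) (closed_imp _ _)) as [Z [HZ K]]. exists Z. split; trivial.
      intro x. rewrite <- K, vals_comp, tens_comm. now apply tens_adj.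
    - destruct (IHu (imp (vals y) Y) (closed_imp _ _)) as [Z [HZ K]]. exists Z. split; trivial.
      intro x. rewrite <- K, vals_comp. now apply tens_adj. }
  apply H, vald_closed.
Qed.

Lemma imp_mp X Y Z : closed Y -> subset Z X -> subset (tens Z (imp X Y)) Y.
Proof.
  intros HY H. apply tens_adj; trivial. intros w Hw x y Hx Hy. apply Hw; auto.
Qed.

(** The unit is orthogonal to the pole, so it may serve as second test point. Both negations thus
    become orthogonality: the double negation axioms follow from closedness, and [tneg a] and
    [mneg a] have the same value. *)
Lemma neg_orth X : imp X (pole M) = orth X.
Proof.
  apply set_eq.
  - intros w Hw x Hx. rewrite <- (mul_unr M (x ** w)). apply Hw; trivial.
    rewrite orth_pole. apply cl_self.
  - intros w Hw. apply tens_adj with (Y := orth X); trivial; [apply closed_pole |].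
    apply tens_spec; [apply closed_pole |]. intros x y Hx Hy. now apply Hy.
Qed.

Lemma imp_contra X Y : closed X -> closed Y -> subset (imp X (orth Y)) (imp Y (orth X)).
Proof.
  intros HX HY w Hw x y Hx Hy. rewrite HX in Hy.
  assert (K : pole M (y ** w ** x)) by (apply Hw; [trivial | now rewrite HY]).
  now apply pole_rot, pole_comm3, pole_rot, pole_rot.
Qed.

Lemma bang_cases X : bang X = cl (un M) /\ X (un M) \/ bang X = bot.
Proof.
  unfold bang. destruct (classic (X (un M))) as [H | H]; [left; split; trivial | right].
  - unfold cl. do 2 f_equal. apply set_eq; intros x; [now intros [-> _] | intros ->; now split].
  - unfold bot. do 2 f_equal. apply set_eq; intros x; [now intros [-> ?] | now intros []].
Qed.

(** The unit is neutral and [bot] absorbing for [tens], so these two values are closed under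
    composition. The structural rules for [k] then need checking for these two values only. *)
Lemma kstr_cases k : kstr k -> vals k = cl (un M) \/ vals k = bot.
Proof.
  destruct k as [t |]; [| now left]. simpl. induction t as [a | x IHx y IHy]; simpl.
  - destruct a; try contradiction. intros _. simpl. destruct (bang_cases (val a)); tauto.
  - intros [Hx Hy]. destruct (IHx Hx) as [-> | ->].
    + destruct (IHy Hy) as [-> | ->].
      * left. apply tens_un, orth_closed.
      * right. apply tens_un, orth_closed.
    + right. apply tens_bot.
Qed.

Lemma kstr_assoc k y z : kstr k ->
  tens (tens (vals k) (vals y)) (vals z) = tens (vals k) (tens (vals y) (vals z)).
Proof.
  intro H. destruct (kstr_cases k H) as [-> | ->].
  - rewrite !tens_un; trivial; [apply closed_tens | apply vals_closed].
  - now rewrite !tens_bot.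
Qed.

Lemma kstr_assoc_r k x y : kstr k ->
  tens (tens (vals x) (vals y)) (vals k) = tens (vals x) (tens (vals y) (vals k)).
Proof.
  intro H. rewrite (tens_comm (vals x) (tens (vals y) _)), (tens_comm (vals y) (vals k)).
  rewrite (kstr_assoc k), (tens_comm (vals y)) by trivial. apply tens_comm.
Qed.

(** Rules (e) and (c) hold by [tens_comm] and [tens_contr], so the flags [e] and [c] stay
    arbitrary. *)
Theorem soundness e c x d : prov true e c x d -> subset (vals x) (vald d).
Proof.
  induction 1; cbn [vals valn val vald sf tneg mneg] in *;
    (* In the rules with a context, premises and conclusion are compared with the same closed set
       [Z]. *)
    try (destruct (fill_adj u d) as [Z [HZ Adj]]; rewrite !Adj in *;
         clear Adj; rewrite ?vals_comp in *; cbn [vals valn val vald sf] in *).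
  - now intros ?.
  - now intros ?.
  - now intros ?.
  - rewrite !neg_orth. now rewrite val_closed.
  - rewrite !neg_orth. now rewrite val_closed.
  - rewrite !neg_orth. apply imp_contra; apply val_closed.
  - rewrite !neg_orth. apply imp_contra; apply val_closed.
  - now intros ?.
  - now intros ?.
  - intros y Hy. auto.
  - trivial.
  - trivial.
  - intros y Hy. eapply IHprov2, imp_mp, Hy; trivial. apply val_closed.
  - rewrite vals_comp in IHprov. apply tens_adj in IHprov; trivial. apply val_closed.
  - rewrite tens_comm. intros y Hy. eapply IHprov2, imp_mp, Hy; trivial. apply val_closed.
  - rewrite vals_comp, tens_comm in IHprov. apply tens_adj in IHprov; trivial. apply val_closed.
  - trivial.
  - rewrite vals_comp. now apply tens_mono.
  - intros y [Hy _]. auto.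
  - intros y [_ Hy]. auto.
  - intros y Hy. split; auto.
  - apply closed_incl; trivial. intros y [Hy | Hy]; auto.
  - intros y Hy. apply orth_orth. auto.
  - intros y Hy. apply orth_orth. auto.
  - apply closed_incl; trivial. intros y [-> Hy]. auto.
  - destruct (bang_cases (val a)) as [[-> _] | E].
    + destruct (kstr_cases k H) as [-> | ->]; [now intros ? | apply bot_incl, orth_closed].
    + destruct (kstr_cases k H) as [K | ->]; [| apply bot_incl, orth_closed].
      rewrite K in *. intros y Hy. unfold bang. assert (val a (un M)) by apply IHprov, cl_self.
      revert y Hy. apply cl_incl; [apply orth_closed |]. apply orth_orth. now split.
  - destruct (kstr_cases k H) as [-> | ->]; trivial. now apply bot_incl.
  - destruct (kstr_cases k H) as [E | E]; rewrite E in *.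
    + now rewrite tens_un in IHprov by apply orth_closed.
    + now apply bot_incl.
  - now rewrite tens_comm.
  - now rewrite tens_comm.
  - now rewrite <- kstr_assoc.
  - now rewrite kstr_assoc.
  - now rewrite <- kstr_assoc_r.
  - now rewrite kstr_assoc_r.
  - now rewrite tens_comm.
  - intros y Hy. now apply IHprov, tens_contr.
Qed.

End Phase.

(** * Guarded stack machines and their axioms *)

Definition upd {A} (v : nat -> A) (i : nat) (x : A) : nat -> A :=
  fun j => if j =? i then x else v j.

Lemma upd_same {A} (v : nat -> A) i x : upd v i x i = x.
Proof. unfold upd. now rewrite Nat.eqb_refl. Qed.

Lemma upd_other {A} (v : nat -> A) i x j : j <> i -> upd v i x j = v j.
Proof. intro H. unfold upd. now apply Nat.eqb_neq in H as ->. Qed.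

(* A configuration [v] assigns to every component [j < K] its state and stack height. [r_pop] and
   the booleans in [r_alts] say whether a letter is popped or pushed; [r_guard r j] is the state
   required of component [j], and whether its stack must be empty. *)
Record rule := Rule {
  r_comp : nat;
  r_pre : nat;
  r_pop : bool;
  r_alts : list (nat * bool);
  r_guard : nat -> nat * bool
}.

Definition guard_ok (K : nat) (r : rule) (v : nat -> nat * nat) : Prop :=
  forall j, j < K -> j <> r_comp r ->
    fst (v j) = fst (r_guard r j) /\ (snd (r_guard r j) = true -> snd (v j) = 0).

Inductive acc (R : list rule) (K : nat) : (nat -> nat * nat) -> Prop :=
| acc_step r v m :
    In r R -> v (r_comp r) = (r_pre r, Nat.b2n (r_pop r) + m) -> guard_ok K r v ->
    (forall s b, In (s, b) (r_alts r) ->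
       acc R K (upd v (r_comp r) (s, Nat.b2n b + m))) ->
    acc R K v.

(* [TS s] is the state [s], [TE s] the same state once its stack may be erased, and [TC k] the token
   that demands a check of the guard of rule number [k]. *)
Inductive tok := TS (s : nat) | TE (s : nat) | TC (r : nat).

(** The first number separates the kinds of tokens; kind 3 is left for the stack letters [letv]. *)
Definition tok_code (t : tok) : nat * nat :=
  match t with TS s => (0, s) | TE s => (1, s) | TC r => (2, r) end.

Definition tokv (j : nat) (t : tok) : fm :=
  Var (to_nat (fst (tok_code t), to_nat (j, snd (tok_code t)))).
Definition letv (j : nat) : fm := Var (to_nat (3, to_nat (j, 0))).

Definition ltok (j : nat) (t : tok) (b : bool) : fm :=
  if b then Mul (tokv j t) (letv j) else tokv j t.

Definition rule_fm (k : nat) (r : rule) : fm :=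
  Ldiv (ltok (r_comp r) (TS (r_pre r)) (r_pop r))
    (fold_right (fun p F => Or (ltok (r_comp r) (TS (fst p)) (snd p)) F)
       (tokv (r_comp r) (TC k)) (r_alts r)).

Definition absorb_fm (j : nat) (t : tok) : fm :=
  Ldiv (ltok j t true) (tokv j t).

Definition prod_fm (t : nat -> tok) (l : list nat) : fm :=
  fold_right (fun j F => Mul F (tokv j (t j))) One l.

(** Emptiness of a stack is tested by demanding [TS]: letters are absorbed only by [TC] and [TE], so
    a [TS] token can stand alone only if no letter was attached to it. *)
Definition goal_tok (k : nat) (r : rule) (j : nat) : tok :=
  if j =? r_comp r then TC k
  else if snd (r_guard r j) then TS (fst (r_guard r j)) else TE (fst (r_guard r j)).

Definition goal_fm (K k : nat) (r : rule) : fm :=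
  Ldiv (prod_fm (goal_tok k r) (seq 0 K)) Zero.

Definition erase_fm (j s : nat) : fm := Ldiv (tokv j (TS s)) (tokv j (TE s)).

Definition rule_axioms (K k : nat) (r : rule) : list fm :=
  rule_fm k r :: absorb_fm (r_comp r) (TC k) :: goal_fm K k r ::
  map (fun j => erase_fm j (fst (r_guard r j))) (seq 0 K) ++
  map (fun j => absorb_fm j (TE (fst (r_guard r j)))) (seq 0 K).

Definition theory (R : list rule) (K : nat) : list fm :=
  flat_map (fun k => match nth_error R k with Some r => rule_axioms K k r | None => [] end)
    (seq 0 (length R)).

Definition big_and (l : list fm) : fm := fold_right And One l.

(** Component 0 holds the input. Its stack is a left comb around the state token, so one more unit
    costs one composition and the code of [num m] is primitive recursive in [m]. *)
Fixpoint num (m : nat) : nstr :=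
  match m with 0 => NF (tokv 0 (TS 0)) | S m => NC (num m) (NF (letv 0)) end.

Definition machine_fm (R : list rule) (K : nat) (s0 : nat -> nat) : fm :=
  Mul (Bang (big_and (theory R K))) (prod_fm (fun j => TS (s0 j)) (seq 1 (K - 1))).

Definition init (s0 : nat -> nat) (m : nat) (j : nat) : nat * nat :=
  if j =? 0 then (0, m) else (s0 j, 0).

Lemma in_theory R K F :
  In F (theory R K) <-> exists k r, nth_error R k = Some r /\ In F (rule_axioms K k r).
Proof.
  unfold theory. rewrite in_flat_map. split.
  - intros [k [_ H]]. destruct (nth_error R k) as [r |] eqn:E; [eauto | contradiction].
  - intros [k [r [E H]]]. exists k. rewrite E. split; trivial. apply in_seq.
    assert (k < length R) by (apply nth_error_Some; congruence). lia.
Qed.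

(** * The model of unrooted trees *)

Section Trees.
Variables (R : list rule) (K : nat).

(* What a rooted tree contributes to an unrooted one: [PT f u l a] has the tokens [u :: l] and the
   stack letters [a], and [f] counts the letters attached since two pieces with tokens were last
   joined. Once all tokens are present, at most one more letter can be attached, namely at the root.
   Two letters joined directly make junk. *)
Inductive piece :=
| PU
| PL (j : nat)
| PT (f : nat) (t : nat * tok) (l : list (nat * tok)) (a : list nat).

Definition pmul (x y : piece) : piece :=
  match x, y with
  | PU, _ => y
  | _, PU => x
  | PL _, PL _ => PT 0 (K, TS 0) [] []
  | PL j, PT f t l a | PT f t l a, PL j => PT (S f) t l (j :: a)
  | PT _ t l a, PT _ t' l' a' => PT 0 t (l ++ t' :: l') (a ++ a')
  end.

Notation count := (count_occ Nat.eq_dec).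

Definition compat (L : list (nat * tok)) (a : list nat) (v : nat -> nat * nat) (j : nat) : Prop :=
  In (j, TS (fst (v j))) L /\ snd (v j) = count a j \/ In (j, TE (fst (v j))) L.

(* The height of an erased stack is unknown, so acceptance is required for all heights. *)
Definition run_ok (L : list (nat * tok)) (a : list nat) : Prop :=
  (forall j, j < K -> exists s, In (j, TS s) L \/ In (j, TE s) L) /\
  forall v, (forall j, j < K -> compat L a v j) -> acc R K v.

Definition check_ok (L : list (nat * tok)) (a : list nat) : Prop :=
  exists k r, nth_error R k = Some r /\ In (r_comp r, TC k) L /\
    forall j, j < K -> j <> r_comp r ->
      In (j, TS (fst (r_guard r j))) L /\ (snd (r_guard r j) = true -> count a j = 0) \/
      In (j, TE (fst (r_guard r j))) L /\ snd (r_guard r j) = false.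

Definition good (L : list (nat * tok)) (a : list nat) : Prop :=
  NoDup (map fst L) /\ (forall j, In j (map fst L) <-> j < K) /\ (run_ok L a \/ check_ok L a).

Definition ppole (x : piece) : Prop :=
  match x with PT f t l a => f <= 1 /\ good (t :: l) a | _ => False end.

Lemma good_perm L L' a a' :
  Permutation L L' -> Permutation a a' -> good L a -> good L' a'.
Proof.
  intros HL Ha (H1 & H2 & H3).
  assert (C : forall j, count a' j = count a j)
    by (intro j; symmetry; now apply Permutation_count_occ).
  assert (I : forall x, In x L' <-> In x L)
    by (intro; split; apply Permutation_in; trivial; now apply Permutation_sym).
  split; [| split].
  - eapply Permutation_NoDup, H1. now apply Permutation_map.
  - intro j. rewrite <- H2. split; apply Permutation_in, Permutation_map; trivial.
    now apply Permutation_sym.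
  - destruct H3 as [[A B] | (k & r & A & B & D)]; [left | right].
    + split.
      * intros j Hj. destruct (A j Hj) as [s Hs]. exists s. now rewrite !I.
      * intros v Hv. apply B. intros j Hj. specialize (Hv j Hj). unfold compat in *.
        now rewrite !I, C in Hv.
    + exists k, r. split; trivial. split; [now apply I |].
      intros j Hj N. rewrite !I, C. auto.
Qed.

Lemma tok_dec (x y : nat * tok) : {x = y} + {x <> y}.
Proof. repeat decide equality. Qed.

Ltac perm dec :=
  apply (Permutation_count_occ dec); intro; cbn [count_occ app];
  repeat (rewrite count_occ_app || cbn [count_occ app]);
  repeat match goal with |- context [if ?b then _ else _] => destruct b end; lia.

(** Components are numbered below [K]; the token at [K] that [pmul] creates from two letters
    therefore spoils every product containing it. *)
Lemma good_junk x L a : In (K, x) L -> ~ good L a.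
Proof.
  intros H (_ & H2 & _). assert (K < K); [| lia]. apply H2.
  now apply (in_map fst) in H.
Qed.

Lemma pmul_unr x : pmul x PU = x.
Proof. now destruct x. Qed.

Ltac pieces :=
  revert_last_good; apply good_perm; (perm tok_dec || perm Nat.eq_dec)
with revert_last_good := match goal with H : good _ _ |- _ => revert H end.

Lemma ppole_comm x y : ppole (pmul x y) -> ppole (pmul y x).
Proof.
  destruct x, y; cbn; trivial; intros [H1 H2]; split; trivial; pieces.
Qed.

Lemma ppole_comm3 x y z : ppole (pmul (pmul x y) z) -> ppole (pmul (pmul y x) z).
Proof.
  destruct x, y, z; cbn; trivial; intros [H1 H2]; split; try lia; pieces.
Qed.

(** The bound on the counter in [ppole] is essential: if two letters were attached in succession to
    a complete tree, regrouping would join them directly and give junk. *)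
Lemma ppole_assoc x y z : ppole (pmul (pmul x y) z) -> ppole (pmul x (pmul y z)).
Proof.
  destruct x, y, z; cbn; trivial; intros [H1 H2]; try lia;
    try (exfalso; revert H2; apply good_junk with (x := TS 0);
         cbn [In]; rewrite ?in_app_iff; cbn [In]; tauto);
    (split; [lia | pieces]).
Qed.

(** The square of a letter is junk, and the square of a piece with tokens repeats a component; only
    [PU] satisfies the hypothesis. *)
Lemma ppole_contr x z : ppole (pmul (pmul x x) z) -> ppole (pmul x z).
Proof.
  destruct x as [| j | f t l a]; cbn; [destruct z; trivial | |].
  - destruct z; cbn; trivial; intros [H1 H2]; apply (good_junk (TS 0)) in H2; cbn; tauto.
  - assert (N : forall L b, ~ good (t :: (l ++ t :: l) ++ L) b).
    { intros L b [H _]. cbn in H. apply NoDup_cons_iff in H as [H _]. apply H.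
      rewrite !map_app, !in_app_iff. cbn. tauto. }
    destruct z; cbn; intros [_ H]; exfalso.
    + apply (N [] (a ++ a)). now rewrite app_nil_r.
    + apply (N [] (j :: a ++ a)). now rewrite app_nil_r.
    + apply (N _ _ H).
Qed.

Definition pieces_phase : phase :=
  Build_phase piece PU pmul ppole (fun x => eq_refl) pmul_unr
    ppole_comm ppole_comm3 ppole_assoc ppole_contr.

(** * Tokens as points and validity of the axioms *)

Hypothesis K_ge2 : 2 <= K.

Definition letters (j : nat) (b : bool) : list nat := if b then [j] else [].
Definition ptok (j : nat) (t : tok) (b : bool) : piece :=
  PT (Nat.b2n b) (j, t) [] (letters j b).

Definition point (n : nat) : piece :=
  let (g, p) := of_nat n in
  let (j, s) := of_nat p in
  match g with
  | 0 => ptok j (TS s) false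
  | 1 => ptok j (TE s) false
  | 2 => ptok j (TC s) false
  | _ => PL j
  end.

Notation M := pieces_phase.
Notation sem := (val M point).

Lemma val_tokv j t : sem (tokv j t) = cl M (ptok j t false).
Proof.
  unfold tokv. cbn [val]. unfold point. rewrite cancel_of_to, cancel_of_to.
  now destruct t.
Qed.

Lemma val_letv j : sem (letv j) = cl M (PL j).
Proof. unfold letv. cbn [val]. unfold point. now rewrite cancel_of_to, cancel_of_to. Qed.

Lemma val_ltok j t b : sem (ltok j t b) = cl M (ptok j t b).
Proof.
  destruct b; [| apply val_tokv]. cbn [ltok val].
  now rewrite val_tokv, val_letv, tens_cl.
Qed.

(* A single token is never a whole tree, so it can only meet a piece carrying the other tokens. *)
Lemma ptok_pole j t b y :
  ppole (pmul (ptok j t b) y) <->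
  exists f u l a, y = PT f u l a /\ good ((j, t) :: u :: l) (letters j b ++ a).
Proof.
  split.
  - assert (N : forall a, ~ good [(j, t)] a).
    { intros a (_ & H & _). destruct (H 0) as [_ H0]. destruct (H 1) as [_ H1].
      cbn in H0, H1. lia. }
    destruct y as [| i | f u l a]; cbn; intros [_ H]; try now apply N in H.
    now exists f, u, l, a.
  - intros (f & u & l & a & -> & H). cbn. split; [lia | exact H].
Qed.

Lemma cl_intro x y : (forall w, ppole (pmul x w) -> ppole (pmul y w)) -> cl M x y.
Proof.
  intros H w Hw. apply pole_comm. apply H. now apply Hw.
Qed.

Lemma good_key j t t' L a : good ((j, t) :: L) a -> In (j, t') L -> False.
Proof.
  intros [H _] HI. cbn in H. apply NoDup_cons_iff in H as [H _]. apply H.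
  now apply (in_map fst) in HI.
Qed.

Lemma good_unique j t t' L a : good L a -> In (j, t) L -> In (j, t') L -> t = t'.
Proof.
  intros [H _]. induction L as [| [i u] L IH]; cbn in *; [contradiction |].
  apply NoDup_cons_iff in H as [H1 H2].
  intros [E | E] [E' | E'].
  - congruence.
  - exfalso. apply H1. injection E as -> ->. now apply (in_map fst) in E'.
  - exfalso. apply H1. injection E' as -> ->. now apply (in_map fst) in E.
  - auto.
Qed.

Lemma good_swap j t t' L a a' :
  good ((j, t) :: L) a -> run_ok ((j, t') :: L) a' \/ check_ok ((j, t') :: L) a' ->
  good ((j, t') :: L) a'.
Proof. intros (H1 & H2 & _) H. split; [exact H1 | split; [exact H2 | exact H]]. Qed.

Lemma good_lt j t L a : good ((j, t) :: L) a -> j < K.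
Proof. intros (_ & H & _). apply H. now left. Qed.

(** Components occur once, so a component with a check token has no state token. This excludes
    [run_ok], and in [check_ok] it forces the rule to be number [k] with component [j]. *)
Lemma good_check k j L a :
  good ((j, TC k) :: L) a ->
  exists r, nth_error R k = Some r /\ r_comp r = j /\ forall i, i < K -> i <> j ->
      In (i, TS (fst (r_guard r i))) L /\ (snd (r_guard r i) = true -> count a i = 0) \/
      In (i, TE (fst (r_guard r i))) L /\ snd (r_guard r i) = false.
Proof.
  intro G. pose proof (good_lt _ _ _ _ G) as Hj.
  assert (G' := G). destruct G as (_ & _ & [[H _] | (k' & r & E & HI & H)]).
  - exfalso. destruct (H j Hj) as [s [[Hs | Hs] | [Hs | Hs]]]; try discriminate;
      eapply good_key; eassumption.
  - assert (E' : r_comp r = j).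
    { destruct (Nat.eq_dec j (r_comp r)) as [| N]; [now symmetry |]. exfalso.
      destruct (H j Hj N) as [[[I | I] _] | [[I | I] _]]; try discriminate;
        eapply good_key; eassumption. }
    assert (k' = k).
    { destruct HI as [I | I]; [congruence |]. rewrite E' in I.
      exfalso; eapply good_key; eassumption. }
    subst k'. exists r. split; trivial. split; trivial.
    intros i Hi N. destruct (H i Hi) as [[[I | I] Z] | [[I | I] Z]]; try congruence; auto.
Qed.

Lemma good_run j s L a :
  good ((j, TS s) :: L) a -> (forall i k, ~ In (i, TC k) L) -> run_ok ((j, TS s) :: L) a.
Proof.
  intros (_ & _ & [H | (k & r & _ & [E | E] & _)]) N; trivial; [discriminate |].
  now apply N in E.
Qed.

Lemma count_letters i j b : count (letters j b) i = if i =? j then Nat.b2n b else 0.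
Proof.
  destruct b; cbn; destruct (Nat.eq_dec j i) as [-> | N];
    rewrite ?Nat.eqb_refl; trivial; destruct (Nat.eqb_spec i j); congruence.
Qed.

(** The tree with the check token supplies the guard, the trees of the alternatives supply
    acceptance of the successors, and together these are the premises of [acc_step]. Erased
    components are harmless: their heights are universally quantified before and after the step. *)
Lemma good_rule k r L a :
  nth_error R k = Some r -> good ((r_comp r, TC k) :: L) a ->
  (forall s b, In (s, b) (r_alts r) ->
     good ((r_comp r, TS s) :: L) (letters (r_comp r) b ++ a)) ->
  good ((r_comp r, TS (r_pre r)) :: L) (letters (r_comp r) (r_pop r) ++ a).
Proof.
  intros E G Alt. apply (good_swap _ _ _ _ _ _ G). left.
  destruct (good_check _ _ _ _ G) as (r' & E' & _ & H).
  assert (r' = r) by congruence. subst r'. clear E'.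
  pose proof (good_lt _ _ _ _ G) as Hi.
  (* By the guard, all other components carry state tokens. Hence each alternative is free of check
     tokens and can be good only through [run_ok]. *)
  assert (NC : forall i k', ~ In (i, TC k') L).
  { intros i k' I.
    assert (i < K) by (apply G; right; now apply (in_map fst) in I).
    assert (N : i <> r_comp r) by (intros ->; eapply good_key; eassumption).
    destruct (H i) as [[I' _] | [I' _]]; trivial;
      now pose proof (good_unique _ _ _ _ _ G (or_intror I) (or_intror I')). }
  split.
  - intros j Hj. destruct (Nat.eq_dec j (r_comp r)) as [-> | N].
    + exists (r_pre r). left. now left.
    + exists (fst (r_guard r j)). destruct (H j Hj N) as [[I _] | [I _]]; cbn; tauto.
  - intros v Hv.
    assert (Hc : forall j, j <> r_comp r -> forall b, count (letters (r_comp r) b ++ a) j = count a j).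
    { intros j N b. rewrite count_occ_app, count_letters.
      now apply Nat.eqb_neq in N as ->. }
    apply acc_step with (r := r) (m := count a (r_comp r)).
    + now apply nth_error_In in E.
    + destruct (v (r_comp r)) as [s n] eqn:Ev.
      destruct (Hv _ Hi) as [[[I | I] C] | [I | I]]; rewrite Ev in *; cbn [fst snd] in *.
      * rewrite count_occ_app, count_letters, Nat.eqb_refl in C. congruence.
      * exfalso; eapply good_key; eassumption.
      * discriminate.
      * exfalso; eapply good_key; eassumption.
    + intros j Hj N. specialize (Hv j Hj). unfold compat in Hv. rewrite Hc in Hv by trivial.
      cbn [In] in Hv.
      destruct Hv as [[[I | I] C] | [I | I]]; try congruence;
      destruct (H j Hj N) as [[I' Z] | [I' Z]];
        pose proof (good_unique _ _ _ _ _ G (or_intror I) (or_intror I')) as U;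
        try discriminate; injection U as U; rewrite U; split; trivial; intro; try congruence.
      rewrite C; auto.
    + intros s b Hs. specialize (Alt s b Hs).
      destruct (good_run _ _ _ _ Alt NC) as [_ Hacc]. apply Hacc.
      intros j Hj. unfold compat. destruct (Nat.eq_dec j (r_comp r)) as [-> | N].
      * left. rewrite upd_same. cbn [fst snd]. split; [now left |].
        now rewrite count_occ_app, count_letters, Nat.eqb_refl.
      * rewrite upd_other, Hc by trivial.
        specialize (Hv j Hj). unfold compat in Hv. rewrite Hc in Hv by trivial.
        cbn [In] in *. destruct Hv as [[[I | I] C] | [I | I]]; try congruence; auto.
Qed.

Lemma good_absorb k j L a :
  good ((j, TC k) :: L) a -> good ((j, TC k) :: L) (j :: a).
Proof.
  intro G. apply (good_swap _ _ _ _ _ _ G). right.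
  destruct (good_check _ _ _ _ G) as (r & E & Ej & H).
  exists k, r. split; trivial. split; [subst; now left |]. rewrite Ej.
  intros i Hi N. cbn [In count_occ]. destruct (Nat.eq_dec j i); [congruence |].
  destruct (H i Hi N); tauto.
Qed.

Lemma good_absorb_erased s j L a :
  good ((j, TE s) :: L) a -> good ((j, TE s) :: L) (j :: a).
Proof.
  intro G. apply (good_swap _ _ _ _ _ _ G). assert (G' := G).
  destruct G as (_ & _ & [[A B] | (k & r & E & I & H)]); [left | right].
  - split; trivial. intros v Hv. apply B. intros i Hi. specialize (Hv i Hi).
    unfold compat in *. cbn [In count_occ] in *. destruct (Nat.eq_dec j i) as [<- | N]; trivial.
    destruct Hv as [[[X | X] _] | X]; [discriminate | | tauto].
    exfalso; eapply good_key; eassumption.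
  - exists k, r. split; trivial. split; trivial. intros i Hi N.
    specialize (H i Hi N). cbn [In count_occ] in *.
    destruct (Nat.eq_dec j i) as [<- | N']; trivial.
    destruct H as [[[X | X] _] | X]; [discriminate | | tauto].
    exfalso; eapply good_key; eassumption.
Qed.

(** Every configuration compatible with the unerased token is compatible with the erased one, so
    fewer configurations remain to be accepted. *)
Lemma good_erase s j L a :
  good ((j, TE s) :: L) a -> good ((j, TS s) :: L) a.
Proof.
  intro G. apply (good_swap _ _ _ _ _ _ G). assert (G' := G).
  destruct G as (_ & _ & [[A B] | (k & r & E & I & H)]); [left | right].
  - split.
    + intros i Hi. destruct (A i Hi) as [s' [[X | X] | [X | X]]]; try discriminate.
      * exists s'. left. now right.
      * exists s. injection X as <- <-. left. now left.
      * exists s'. right. now right.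
    + intros v Hv. apply B. intros i Hi. specialize (Hv i Hi).
      unfold compat in *. cbn [In] in *.
      destruct Hv as [[[X | X] C] | [X | X]]; try discriminate; try tauto.
      right. left. congruence.
  - exists k, r. split; trivial. split.
    + destruct I; [discriminate | now right].
    + intros i Hi N. destruct (H i Hi N) as [[[X | X] Z] | [[X | X] Z]]; try discriminate; cbn; try tauto.
      left. split; [left; congruence | congruence].
Qed.

(** The unit lies in an implication when one value is included in the other; a principal value need
    only be tested at its generator. *)
Lemma val_ldiv_un A B x : sem A = cl M x -> sem B x -> sem (Ldiv A B) PU.
Proof.
  intros HA HB. cbn [val]. rewrite HA. intros a y Ha Hy.
  change PU with (un M). rewrite mul_unr. apply Hy.
  revert a Ha. apply cl_incl; [apply val_closed | exact HB].
Qed.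

Fixpoint pprod (t : nat -> tok) (l : list nat) : piece :=
  match l with [] => PU | j :: l => pmul (pprod t l) (ptok j (t j) false) end.

Lemma val_prod t l : sem (prod_fm t l) = cl M (pprod t l).
Proof.
  induction l as [| j l IH]; cbn [prod_fm fold_right val pprod]; [reflexivity |].
  fold (prod_fm t l). now rewrite IH, val_tokv, tens_cl.
Qed.

Lemma pprod_shape t l : l <> [] ->
  exists u L, pprod t l = PT 0 u L [] /\ Permutation (u :: L) (map (fun j => (j, t j)) l).
Proof.
  induction l as [| j l IH]; [congruence | intros _]. cbn [pprod map].
  destruct l as [| i l].
  - exists (j, t j), []. now split.
  - destruct IH as (u & L & -> & P); [discriminate |].
    exists u, (L ++ [(j, t j)]). split; [reflexivity |].
    rewrite <- P. perm tok_dec.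
Qed.

Lemma good_goal k r :
  nth_error R k = Some r -> r_comp r < K ->
  good (map (fun j => (j, goal_tok k r j)) (seq 0 K)) [].
Proof.
  intros E Hr.
  assert (Ex : map fst (map (fun j => (j, goal_tok k r j)) (seq 0 K)) = seq 0 K).
  { rewrite map_map. apply map_id. }
  assert (I : forall j, j < K -> In (j, goal_tok k r j) (map (fun j => (j, goal_tok k r j)) (seq 0 K))).
  { intros j Hj. apply in_map_iff. exists j. split; trivial. apply in_seq. lia. }
  split; [| split].
  - rewrite Ex. apply seq_NoDup.
  - intro j. rewrite Ex, in_seq. lia.
  - right. exists k, r. split; trivial. split.
    + specialize (I _ Hr). unfold goal_tok in I at 1. now rewrite Nat.eqb_refl in I.
    + intros j Hj N. specialize (I _ Hj). unfold goal_tok in I at 1.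
      apply Nat.eqb_neq in N. rewrite N in I. destruct (snd (r_guard r j)); auto.
Qed.

(** A point is orthogonal to a join exactly when it is orthogonal to each part. A test point
    therefore meets all successors and the check at once, which is how the disjunction synchronises
    components. *)
Lemma join_alts k r z :
  (forall w, (forall s b, In (s, b) (r_alts r) -> ppole (pmul (ptok (r_comp r) (TS s) b) w)) ->
     ppole (pmul (ptok (r_comp r) (TC k) false) w) -> ppole (pmul z w)) ->
  sem (fold_right (fun p F => Or (ltok (r_comp r) (TS (fst p)) (snd p)) F)
         (tokv (r_comp r) (TC k)) (r_alts r)) z.
Proof.
  revert z. induction (r_alts r) as [| [s b] l IH]; cbn [fold_right fst snd]; intros z H.
  - rewrite val_tokv. apply cl_intro. intros w Hw. apply H; trivial. now intros.
  - cbn [val]. intros w Hw. apply pole_comm. apply H.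
    + intros s' b' [E | I].
      * injection E as <- <-. apply Hw. left. rewrite val_ltok. apply cl_self.
      * apply Hw. right. apply IH. auto.
    + apply Hw. right. apply IH. auto.
Qed.

Hypothesis comps : forall r, In r R -> r_comp r < K.

Lemma theory_valid F : In F (theory R K) -> sem F PU.
Proof.
  intro HF. apply in_theory in HF as (k & r & E & HF).
  assert (Hr : r_comp r < K) by (apply comps; now apply nth_error_In in E).
  destruct HF as [<- | [<- | [<- | HF]]].
  - apply val_ldiv_un with (1 := val_ltok _ _ _). apply join_alts. intros w Alt C.
    (* Orthogonality to the check token determines the shape of [w] and yields the guard. *)
    apply ptok_pole in C as (f & u & l & a & -> & G). cbn in G.
    apply ptok_pole. exists f, u, l, a. split; trivial.
    apply good_rule with (1 := E); trivial. intros s b Hs.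
    apply Alt, ptok_pole in Hs as (f' & u' & l' & a' & Eq & G'). congruence.
  - apply val_ldiv_un with (1 := val_ltok _ _ _). rewrite val_tokv. apply cl_intro.
    intros w Hw. apply ptok_pole in Hw as (f & u & l & a & -> & G).
    apply ptok_pole. exists f, u, l, a. split; trivial. now apply good_absorb.
  - apply val_ldiv_un with (1 := val_prod _ _). cbn [val].
    destruct (pprod_shape (goal_tok k r) (seq 0 K)) as (u & L & -> & P).
    { destruct K; [lia | discriminate]. }
    cbn. split; [lia |]. eapply good_perm, good_goal; eauto. now apply Permutation_sym.
  - apply in_app_iff in HF as [HF | HF]; apply in_map_iff in HF as (j & <- & _).
    + apply val_ldiv_un with (1 := val_tokv _ _). rewrite val_tokv. apply cl_intro.
      intros w Hw. apply ptok_pole in Hw as (f & u & l & a & -> & G).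
      apply ptok_pole. exists f, u, l, a. split; trivial. now apply good_erase.
    + apply val_ldiv_un with (1 := val_ltok _ _ _). rewrite val_tokv. apply cl_intro.
      intros w Hw. apply ptok_pole in Hw as (f & u & l & a & -> & G).
      apply ptok_pole. exists f, u, l, a. split; trivial. now apply good_absorb_erased.
Qed.

Lemma big_and_valid l : (forall F, In F l -> sem F PU) -> sem (big_and l) PU.
Proof.
  induction l as [| F l IH]; intro H; cbn.
  - apply cl_self with (M := M).
  - split; [apply H; now left | apply IH; intros; apply H; now right].
Qed.

(** The counter [m] may exceed the bound in [ppole]; joining this piece to the one with the
    remaining tokens resets it to 0. *)
Lemma val_num m : valn M point (num m) (PT m (0, TS 0) [] (repeat 0 m)).
Proof.
  induction m as [| m IH]; cbn [num valn].
  - rewrite val_tokv. apply cl_self.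
  - change (PT (S m) (0, TS 0) [] (repeat 0 (S m)))
      with (mul M (PT m (0, TS 0) [] (repeat 0 m)) (PL 0)).
    apply tens_in; trivial. rewrite val_letv. apply cl_self.
Qed.

(** The unit realises the banged theory, so the other factors form a tree in the pole. Having no
    check token, it is good through [run_ok], and [init s0 m] is compatible with it. *)
Theorem machine_sound e c s0 m :
  prov true e c (Some (NC (NF (machine_fm R K s0)) (num m))) None ->
  acc R K (init s0 m).
Proof.
  intro H. apply (soundness M point) in H. cbn [vals valn vald] in H.
  set (t := fun j => TS (s0 j)).
  destruct (pprod_shape t (seq 1 (K - 1))) as (u & L & Eu & P).
  { destruct K as [| [| K']]; try lia. discriminate. }
  assert (G : ppole (pmul (pprod t (seq 1 (K - 1))) (PT m (0, TS 0) [] (repeat 0 m)))).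
  { apply H, (tens_in M); [| apply val_num].
    change (pprod t (seq 1 (K - 1))) with (mul M PU (pprod t (seq 1 (K - 1)))).
    apply tens_in; [| fold t; rewrite val_prod; apply cl_self].
    cbn [val]. apply orth_orth. split; [reflexivity |].
    apply big_and_valid, theory_valid. }
  rewrite Eu in G. cbn in G. destruct G as [_ G].
  assert (G' : good ((0, TS 0) :: map (fun j => (j, t j)) (seq 1 (K - 1))) (repeat 0 m)).
  { revert G. apply good_perm; trivial. rewrite <- P. perm tok_dec. }
  assert (NC : forall i k, ~ In (i, TC k) (map (fun j => (j, t j)) (seq 1 (K - 1)))).
  { intros i k I. apply in_map_iff in I as (j & Ej & _). discriminate. }
  destruct (good_run _ _ _ _ G' NC) as [_ A]. apply A.
  intros j Hj. left. unfold init. destruct (Nat.eqb_spec j 0) as [-> | N]; cbn [fst snd].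
  - split; [now left |]. symmetry. now apply count_occ_repeat_eq.
  - split.
    + right. apply in_map_iff. exists j. split; trivial. apply in_seq. lia.
    + symmetry. now apply count_occ_repeat_neq.
Qed.

End Trees.

(** * Derivations of accepting configurations *)

Section Completeness.
Variables (R : list rule) (K : nat).
Hypothesis comps : forall r, In r R -> r_comp r < K.

Notation P := (prov false false false).
Notation hyp := (sf (Bang (big_and (theory R K)))).

Fixpoint ccomp (u w : ctx) : ctx :=
  match u with
  | Hole => w
  | CL u y => CL (ccomp u w) y
  | CR y u => CR y (ccomp u w)
  end.

Lemma fill_ccomp u w x : fill (ccomp u w) x = fill u (fill w x).
Proof. induction u; cbn; congruence. Qed.

(** Rules (ke), (ka1) and (ka2) let a banged formula pass through any context, although the other
    structures cannot be regrouped. *)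
Lemma hyp_move u w x d :
  P (fill w (fill u (comp x hyp))) d -> P (fill w (comp hyp (fill u x))) d.
Proof.
  assert (Hk : kstr hyp) by exact I.
  revert w. induction u as [| u IH y | y u IH]; intros w H; cbn [fill] in *.
  - now apply r_ke2.
  - apply r_ka1a; trivial.
    change (P (fill w (fill (CL Hole y) (comp hyp (fill u x)))) d).
    rewrite <- fill_ccomp. apply IH. now rewrite fill_ccomp.
  - apply r_ke2; trivial. apply r_ka2b; trivial.
    change (P (fill w (fill (CR y Hole) (comp (fill u x) hyp))) d).
    rewrite <- fill_ccomp. apply r_ke1; trivial. apply IH. now rewrite fill_ccomp.
Qed.

Lemma big_and_left l F u d :
  In F l -> P (fill u (sf F)) d -> P (fill u (sf (big_and l))) d.
Proof.
  intros HI H. induction l as [| G l IH]; [contradiction |]. destruct HI; cbn.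
  - subst. now apply r_andL1.
  - now apply r_andL2; auto.
Qed.

(** Derivations are read backwards: in the presence of [hyp], an occurrence of [x] may be rewritten
    to [y] at any depth. *)
Definition step (x y : str) : Prop :=
  forall u, P (comp hyp (fill u y)) None -> P (comp hyp (fill u x)) None.

Lemma step_refl x : step x x.
Proof. now intros u. Qed.

Lemma step_trans x y z : step x y -> step y z -> step x z.
Proof. intros H1 H2 u H. now apply H1, H2. Qed.

Lemma step_fill w x y : step x y -> step (fill w x) (fill w y).
Proof. intros H u. rewrite <- !fill_ccomp. apply H. Qed.

Lemma step_comp x y x' y' : step x x' -> step y y' -> step (comp x y) (comp x' y').
Proof.
  intros H1 H2. apply step_trans with (comp x' y).
  - apply (step_fill (CL Hole y) _ _ H1).
  - apply (step_fill (CR x' Hole) _ _ H2).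
Qed.

Lemma step_mul a b : step (sf (Mul a b)) (comp (sf a) (sf b)).
Proof. intros u. apply (r_mulL _ _ _ (CR hyp u)). Qed.

(** Rule (kc) copies [hyp], the copy travels to the right of [x], is opened and projected to the
    chosen axiom, and is then consumed together with [x]. *)
Lemma step_axiom A B x :
  In (Ldiv A B) (theory R K) -> P x (Some A) -> step x (sf B).
Proof.
  intros HI HA u H. assert (Hk : kstr hyp) by exact I.
  apply (r_kc _ _ _ (CL Hole (fill u x))); trivial. cbn [fill].
  apply (r_ka1b _ _ _ Hole); trivial. cbn [fill].
  apply (hyp_move u (CR hyp Hole)). cbn [fill].
  change (P (comp hyp (fill u (fill (CR x Hole) hyp))) None).
  rewrite <- fill_ccomp. apply (r_bangL _ _ _ (CR hyp (ccomp u (CR x Hole)))).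
  apply big_and_left with (1 := HI). cbn [fill]. rewrite fill_ccomp. cbn [fill].
  now apply (r_ldivL _ _ _ x A B (CR hyp u)).
Qed.

Definition stok (j : nat) (t : tok) (b : bool) : str :=
  if b then comp (sf (tokv j t)) (sf (letv j)) else sf (tokv j t).

Lemma stok_prov j t b : P (stok j t b) (Some (ltok j t b)).
Proof. destruct b; [apply r_mulR |]; apply ax_id. Qed.

Lemma step_ltok j t b : step (sf (ltok j t b)) (stok j t b).
Proof. destruct b; [apply step_mul | apply step_refl]. Qed.

Fixpoint comb (j n : nat) : ctx :=
  match n with 0 => Hole | S n => CL (comb j n) (sf (letv j)) end.

(** Pushes and pops happen next to the token, at the inner end of the comb; as the letters of a
    component are all alike, only their number matters. *)
Lemma comb_inner j n t b :
  fill (comb j (Nat.b2n b + n)) (sf (tokv j t)) = fill (comb j n) (stok j t b).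
Proof. destruct b; trivial. induction n; trivial. cbn in *. congruence. Qed.

Fixpoint spine (X : nat -> str) (l : list nat) : str :=
  match l with [] => None | j :: l => comp (spine X l) (X j) end.

Lemma spine_ext X Y l : (forall j, In j l -> X j = Y j) -> spine X l = spine Y l.
Proof.
  induction l as [| j l IH]; intro H; trivial. cbn.
  rewrite IH, H; trivial; [now left | intros; apply H; now right].
Qed.

(** The context is chosen before [Y], so the same one serves the configuration, its successors and
    the check. *)
Lemma spine_ctx i X l : NoDup l -> In i l ->
  exists u, forall Y, (forall j, j <> i -> Y j = X j) -> spine Y l = fill u (Y i).
Proof.
  induction l as [| j l IH]; intros N HI; [contradiction |].
  apply NoDup_cons_iff in N as [N1 N2]. destruct HI as [-> | HI].
  - exists (CR (spine X l) Hole). intros Y HY. cbn. f_equal.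
    apply spine_ext. intros j Hj. apply HY. now intros ->.
  - destruct (IH N2 HI) as [u Hu]. exists (CL u (X j)). intros Y HY. cbn.
    rewrite Hu, (HY j); trivial. now intros ->.
Qed.

Lemma step_spine X Y l : (forall j, In j l -> step (X j) (Y j)) -> step (spine X l) (spine Y l).
Proof.
  induction l as [| j l IH]; intro H; cbn; [apply step_refl |].
  apply step_comp; [apply IH; intros; apply H; now right | apply H; now left].
Qed.

Lemma spine_prod t l : P (spine (fun j => sf (tokv j (t j))) l) (Some (prod_fm t l)).
Proof. induction l; cbn; [apply ax_one | apply r_mulR; [trivial | apply ax_id]]. Qed.

Lemma step_prod t l : step (sf (prod_fm t l)) (spine (fun j => sf (tokv j (t j))) l).
Proof.
  induction l as [| j l IH]; cbn.
  - intros u. apply (r_oneL _ _ _ (CR hyp u)).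
  - eapply step_trans; [apply step_mul | apply step_comp; [trivial | apply step_refl]].
Qed.

Lemma step_absorb j t n :
  In (absorb_fm j t) (theory R K) -> step (fill (comb j n) (sf (tokv j t))) (sf (tokv j t)).
Proof.
  intro HI. induction n as [| n IH]; cbn [comb fill]; [apply step_refl |].
  eapply step_trans; [apply step_comp; [apply IH | apply step_refl] |].
  apply (step_axiom _ _ _ HI), (stok_prov j t true).
Qed.

Definition branch (v : nat -> nat * nat) (j : nat) : str :=
  fill (comb j (snd (v j))) (sf (tokv j (TS (fst (v j))))).

(** The check token absorbs its own stack. Every other component either has an empty stack, as the
    guard demands, or is erased and absorbs its letters. What remains is the product that the goal
    axiom sends to [Zero]. *)
Lemma check_prov k r v m :
  nth_error R k = Some r -> guard_ok K r v ->
  P (comp hyp (spine (upd (branch v) (r_comp r)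
        (fill (comb (r_comp r) m) (sf (tokv (r_comp r) (TC k))))) (seq 0 K))) None.
Proof.
  intros E G.
  assert (Ax : forall F, In F (rule_axioms K k r) -> In F (theory R K))
    by (intros F HF; apply in_theory; eauto).
  apply (step_trans _ (spine (fun j => sf (tokv j (goal_tok k r j))) (seq 0 K)) (sf Zero))
    with (u := Hole).
  - apply step_spine. intros j Hj. apply in_seq in Hj.
    unfold goal_tok. destruct (Nat.eqb_spec j (r_comp r)) as [-> | N].
    + rewrite upd_same. apply step_absorb, Ax. right. now left.
    + rewrite upd_other by trivial. destruct (G j) as [G1 G2]; [lia | trivial |].
      unfold branch. rewrite G1. destruct (snd (r_guard r j)).
      * rewrite G2 by trivial. apply step_refl.
      * eapply step_trans; [apply step_fill | apply step_absorb].
        -- apply step_axiom with (2 := ax_id _ _ _ _). apply Ax. do 3 right.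
           apply in_app_iff. left. apply (in_map (fun j => erase_fm j (fst (r_guard r j)))).
           apply in_seq. lia.
        -- apply Ax. do 3 right. apply in_app_iff. right.
           apply (in_map (fun j => absorb_fm j (TE (fst (r_guard r j))))). apply in_seq. lia.
  - apply step_axiom with (2 := spine_prod _ _). apply Ax. right. right. now left.
  - apply (r_kw _ _ _ (CL Hole (sf Zero))); [exact I | apply ax_zero].
Qed.

Lemma alts_prov k r w :
  (forall s b, In (s, b) (r_alts r) -> P (comp hyp (fill w (stok (r_comp r) (TS s) b))) None) ->
  P (comp hyp (fill w (sf (tokv (r_comp r) (TC k))))) None ->
  P (comp hyp (fill w (sf
      (fold_right (fun p F => Or (ltok (r_comp r) (TS (fst p)) (snd p)) F)
         (tokv (r_comp r) (TC k)) (r_alts r))))) None.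
Proof.
  induction (r_alts r) as [| [s b] l IH]; intros H C; cbn [fold_right fst snd]; trivial.
  apply (r_orL _ _ _ (CR hyp w)).
  - apply step_ltok, H. now left.
  - apply IH; trivial. intros; apply H; now right.
Qed.

Lemma acc_prov v : acc R K v -> P (comp hyp (spine (branch v) (seq 0 K))) None.
Proof.
  induction 1 as [r v m HI Ev G _ IH].
  destruct (In_nth_error _ _ HI) as [k E].
  destruct (spine_ctx (r_comp r) (branch v) (seq 0 K)) as [u Hu].
  { apply seq_NoDup. }
  { apply in_seq. specialize (comps r HI). lia. }
  rewrite (Hu (branch v)) by trivial. unfold branch. rewrite Ev. cbn [fst snd].
  rewrite comb_inner, <- fill_ccomp.
  eapply step_axiom.
  - apply in_theory. exists k, r. split; [exact E | now left].
  - apply stok_prov.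
  - apply alts_prov.
    + intros s b Hs. specialize (IH s b Hs). rewrite Hu in IH.
      * unfold branch in IH. rewrite upd_same in IH. cbn [fst snd] in IH.
        now rewrite comb_inner, <- fill_ccomp in IH.
      * intros j N. unfold branch. now rewrite upd_other.
    + pose proof (check_prov k r v m E G) as C. rewrite Hu in C.
      * now rewrite upd_same, <- fill_ccomp in C.
      * intros j N. now rewrite upd_other.
Qed.

Lemma branch_num s0 m : branch (init s0 m) 0 = Some (num m).
Proof. induction m as [| m IH]; trivial. cbn in *. now rewrite IH. Qed.

Theorem machine_complete s0 m : 0 < K ->
  acc R K (init s0 m) -> P (Some (NC (NF (machine_fm R K s0)) (num m))) None.
Proof.
  intros HK H. apply acc_prov in H.
  (* Component 0 is the last factor of the spine, which is the place of [num m] in the sequent. *)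
  replace (seq 0 K) with (0 :: seq 1 (K - 1)) in H by (destruct K; [lia | cbn; now rewrite Nat.sub_0_r]).
  cbn [spine] in H. rewrite branch_num in H.
  apply (r_mulL _ _ _ (CL Hole (Some (num m)))). cbn [fill].
  apply (r_ka1b _ _ _ Hole); [exact I |]. cbn [fill].
  apply (step_prod _ _ (CL Hole (Some (num m)))). cbn [fill].
  replace (spine (fun j => sf (tokv j (TS (s0 j)))) (seq 1 (K - 1)))
    with (spine (branch (init s0 m)) (seq 1 (K - 1))); trivial.
  apply spine_ext. intros j Hj. apply in_seq in Hj.
  unfold branch, init. destruct (Nat.eqb_spec j 0); [lia | reflexivity].
Qed.

End Completeness.

(** * Alternating counter machines *)

Inductive instr :=
| IInc (q i q' : nat)
| IDec (q i q' : nat)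
| IZero (q i q' : nat)
| IFork (q q1 q2 : nat)
| IHalt (q : nat).

Inductive accepts (I : list instr) : nat -> (nat -> nat) -> Prop :=
| acc_inc q i q' n :
    In (IInc q i q') I -> accepts I q' (upd n i (S (n i))) -> accepts I q n
| acc_dec q i q' n m :
    In (IDec q i q') I -> n i = S m -> accepts I q' (upd n i m) -> accepts I q n
| acc_zero q i q' n :
    In (IZero q i q') I -> n i = 0 -> accepts I q' n -> accepts I q n
| acc_fork q q1 q2 n :
    In (IFork q q1 q2) I -> accepts I q1 n -> accepts I q2 n -> accepts I q n
| acc_halt q n : In (IHalt q) I -> accepts I q n.

Definition instr_reg (x : instr) : nat :=
  match x with IInc _ i _ | IDec _ i _ | IZero _ i _ => i | _ => 0 end.

Section Compile.
Variable N : nat.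

(** The successor keeps busy states apart from the idle state 0; recording both control states ties
    the return step to its own transition. *)
Definition busy (q q' : nat) : nat := S (to_nat (q, q')).

(** Component [N] is the control; the components below it are the registers. *)
Definition idle_guard (q : nat) (j : nat) : nat * bool :=
  if j =? N then (q, false) else (0, false).

(* A register update takes three steps: the register moves from state 0 to [busy q q'],
   then the control moves from [q] to [q'], then the register returns to state 0. *)
Definition handshake (i q q' : nat) : list rule :=
  [ Rule N q false [(q', false)] (upd (idle_guard q) i (busy q q', false));
    Rule i (busy q q') false [(0, false)] (idle_guard q') ].

Definition instr_rules (x : instr) : list rule :=
  match x with
  | IInc q i q' =>
      Rule i 0 false [(busy q q', true)] (idle_guard q) :: handshake i q q'
  | IDec q i q' =>
      Rule i 0 true [(busy q q', false)] (idle_guard q) :: handshake i q q'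
  | IZero q i q' => [Rule N q false [(q', false)] (upd (idle_guard q) i (0, true))]
  | IFork q q1 q2 => [Rule N q false [(q1, false); (q2, false)] (idle_guard q)]
  | IHalt q => [Rule N q false [] (idle_guard q)]
  end.

Variable I : list instr.
Hypothesis regs : forall x, In x I -> instr_reg x < N.

Notation R := (flat_map instr_rules I).
Notation Acc := (acc R (S N)).

Definition conf (q : nat) (n : nat -> nat) (j : nat) : nat * nat :=
  if j =? N then (q, 0) else (0, n j).

Lemma busy_inj q q' p p' : busy q q' = busy p p' -> q = p /\ q' = p'.
Proof.
  unfold busy. intro H. apply Nat.succ_inj, (f_equal of_nat) in H.
  rewrite !cancel_of_to in H. now injection H.
Qed.

Ltac cases :=
  repeat (match goal with
  | |- context [?a =? ?b] => destruct (Nat.eqb_spec a b)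
  | H : context [?a =? ?b] |- _ => destruct (Nat.eqb_spec a b)
  end; try subst; cbn [fst snd] in * ); try congruence; try lia; auto.

Lemma handshake_acc i q q' n x :
  (forall r, In r (handshake i q q') -> In r R) -> i < N ->
  Acc (conf q' (upd n i x)) -> Acc (upd (conf q n) i (busy q q', x)).
Proof.
  intros HR Hi H.
  apply (acc_step _ _ (Rule N q false [(q', false)] (upd (idle_guard q) i (busy q q', false))) _ 0);
    cbn [r_comp r_pre r_pop r_alts r_guard].
  - apply HR. now left.
  - rewrite upd_other by lia. unfold conf. now rewrite Nat.eqb_refl.
  - intros j Hj Nj. cbn in *. unfold upd, conf, idle_guard in *. cases.
  - intros s b [E | []]. injection E as <- <-.
    apply (acc_step _ _ (Rule i (busy q q') false [(0, false)] (idle_guard q')) _ x);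
      cbn [r_comp r_pre r_pop r_alts r_guard].
    + apply HR. right. now left.
    + now rewrite upd_other, upd_same by lia.
    + intros j Hj Nj. cbn in *. unfold upd, conf, idle_guard in *. cases.
    + intros s b [E | []]. injection E as <- <-.
      replace (upd _ i _) with (conf q' (upd n i x)); trivial.
      apply functional_extensionality. intro j. unfold upd, conf. cases.
Qed.

Lemma conf_control q n q' : upd (conf q n) N (q', 0) = conf q' n.
Proof. apply functional_extensionality. intro j. unfold upd, conf. cases. Qed.

Lemma accepts_acc q n : accepts I q n -> Acc (conf q n).
Proof.
  induction 1 as [q i q' n HI _ IH | q i q' n m HI E _ IH | q i q' n HI E _ IH
                 | q q1 q2 n HI _ IH1 _ IH2 | q n HI];
    pose proof (regs _ HI) as Hi; cbn in Hi;
    assert (HR : forall r, In r (instr_rules _) -> In r R)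
      by (intros r Hr; apply in_flat_map; eexists; split; [exact HI | exact Hr]);
    cbn [instr_rules] in HR.
  - eapply (acc_step _ _ _ _ (n i)); [apply HR; now left | | |];
      cbn [r_comp r_pre r_pop r_alts r_guard].
    + unfold conf. cases.
    + intros j Hj Nj. cbn in *. unfold conf, idle_guard. cases.
    + intros s b [E | []]. injection E as <- <-.
      apply handshake_acc; trivial. intros r Hr. apply HR. now right.
  - eapply (acc_step _ _ _ _ m); [apply HR; now left | | |];
      cbn [r_comp r_pre r_pop r_alts r_guard].
    + unfold conf. cases.
    + intros j Hj Nj. cbn in *. unfold conf, idle_guard. cases.
    + intros s b [E' | []]. injection E' as <- <-.
      apply handshake_acc; trivial. intros r Hr. apply HR. now right.
  - eapply (acc_step _ _ _ _ 0); [apply HR; now left | | |];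
      cbn [r_comp r_pre r_pop r_alts r_guard].
    + unfold conf. cases.
    + intros j Hj Nj. cbn in *. unfold conf, idle_guard, upd. cases.
    + intros s b [E' | []]. injection E' as <- <-. now rewrite conf_control.
  - eapply (acc_step _ _ _ _ 0); [apply HR; now left | | |];
      cbn [r_comp r_pre r_pop r_alts r_guard].
    + unfold conf. cases.
    + intros j Hj Nj. cbn in *. unfold conf, idle_guard, upd. cases.
    + intros s b [E' | [E' | []]]; injection E' as <- <-; now rewrite conf_control.
  - eapply (acc_step _ _ _ _ 0); [apply HR; now left | | |];
      cbn [r_comp r_pre r_pop r_alts r_guard].
    + unfold conf. cases.
    + intros j Hj Nj. cbn in *. unfold conf, idle_guard, upd. cases.
    + intros s b [].
Qed.

(** * From the stack machine back to the counter machine *)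

Definition idle (v : nat -> nat * nat) (i : nat) : Prop :=
  forall j, j < N -> j <> i -> fst (v j) = 0.

Definition counts (v : nat -> nat * nat) (j : nat) : nat := snd (v j).

Lemma counts_upd v i s x : counts (upd v i (s, x)) = upd (counts v) i x.
Proof. apply functional_extensionality. intro j. unfold counts, upd. cases. Qed.

Lemma counts_same v i s x : snd (v i) = x -> counts (upd v i (s, x)) = counts v.
Proof.
  intro H. apply functional_extensionality. intro j. unfold counts, upd. cases.
Qed.

(** The second clause describes the middle of a handshake: the register is already updated, so
    whether the control is still at [q] or already at [q'], the computation continues from [q'].
    Nothing is claimed of other configurations. *)
Definition faithful (v : nat -> nat * nat) : Prop :=
  (idle v N -> accepts I (fst (v N)) (counts v)) /\
  (forall i q q', i < N -> fst (v i) = busy q q' -> idle v i ->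
     fst (v N) = q \/ fst (v N) = q' -> accepts I q' (counts v)).

(** Either rule requires a busy register, which contradicts idleness and identifies the transition
    in progress. The first rule stays in the second clause; the second rule leads to the first
    clause. *)
Lemma handshake_faithful v q i q' r m :
  i < N -> In r (handshake i q q') -> v (r_comp r) = (r_pre r, Nat.b2n (r_pop r) + m) ->
  guard_ok (S N) r v ->
  (forall s b, In (s, b) (r_alts r) -> faithful (upd v (r_comp r) (s, Nat.b2n b + m))) ->
  faithful v.
Proof.
  intros Hi [<- | [<- | []]] Ev G IH; cbn [r_comp r_pre r_pop r_alts r_guard Nat.b2n] in *.
  - assert (Gi : fst (v i) = busy q q').
    { destruct (G i) as [G1 _]; cbn; try lia. rewrite G1. cbn. now rewrite upd_same. }
    split.
    + intro Id. rewrite Id in Gi by lia. discriminate.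
    + intros i' p p' Hi' Ev' Id _. destruct (Nat.eq_dec i' i) as [-> | Ne].
      * rewrite Gi in Ev'. apply busy_inj in Ev' as [<- <-].
        destruct (IH q' false) as [_ H]; [now left |].
        rewrite counts_same in H by (now rewrite Ev).
        apply (H i q q'); trivial.
        -- now rewrite upd_other by lia.
        -- intros j Hj Nj. rewrite upd_other by lia. now apply Id.
        -- right. now rewrite upd_same.
      * exfalso. rewrite Id in Gi by lia. discriminate.
  - assert (GN : fst (v N) = q').
    { destruct (G N) as [G1 _]; cbn; try lia. rewrite G1. cbn. unfold idle_guard.
      now rewrite Nat.eqb_refl. }
    split.
    + intro Id. specialize (Id i Hi). rewrite Ev in Id. discriminate Id. lia.
    + intros i' p p' Hi' Ev' Id _. destruct (Nat.eq_dec i' i) as [-> | Ne].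
      * rewrite Ev in Ev'. apply busy_inj in Ev' as [<- <-].
        destruct (IH 0 false) as [H _]; [now left |].
        rewrite counts_same in H by (now rewrite Ev).
        rewrite upd_other, GN in H by lia. apply H.
        intros j Hj _. destruct (Nat.eq_dec j i) as [-> | Nj]; [now rewrite upd_same |].
        rewrite upd_other by lia. now apply Id.
      * exfalso. specialize (Id i Hi). rewrite Ev in Id. discriminate Id. lia.
Qed.

Lemma start_faithful v i q q' x :
  i < N -> fst (v i) = 0 -> (forall j, j < S N -> j <> i -> fst (v j) = fst (idle_guard q j)) ->
  faithful (upd v i (busy q q', x)) ->
  (accepts I q' (upd (counts v) i x) -> accepts I q (counts v)) -> faithful v.
Proof.
  intros Hi Ev G [_ H] HA.
  assert (Z : forall j, j < N -> fst (v j) = 0).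
  { intros j Hj. destruct (Nat.eq_dec j i) as [-> | Ne]; trivial.
    rewrite G by lia. unfold idle_guard. cases. }
  assert (GN : fst (v N) = q) by (rewrite G by lia; unfold idle_guard; cases).
  split.
  - intros _. rewrite GN. apply HA. rewrite <- (counts_upd v i (busy q q')).
    apply (H i q q'); trivial.
    + now rewrite upd_same.
    + intros j Hj Nj. rewrite upd_other by lia. auto.
    + left. now rewrite upd_other by lia.
  - intros i' p p' Hi' E. rewrite Z in E by trivial. discriminate.
Qed.

Lemma control_faithful v q :
  (forall j, j < N -> fst (v j) = 0) -> fst (v N) = q -> accepts I q (counts v) -> faithful v.
Proof.
  intros Z <- H. split; trivial. intros i q p Hi E. rewrite Z in E by trivial. discriminate.
Qed.

Lemma acc_faithful v : Acc v -> faithful v.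
Proof.
  induction 1 as [r v m HR Ev G _ IH].
  apply in_flat_map in HR as (x & HI & Hr).
  pose proof (regs _ HI) as Hi.
  destruct x as [q i q' | q i q' | q i q' | q q1 q2 | q]; cbn in Hi, Hr.
  - destruct Hr as [<- | Hr]; [| now apply (handshake_faithful v q i q' r m)].
    cbn [r_comp r_pre r_pop r_alts r_guard Nat.b2n] in *.
    apply (start_faithful v i q q' (1 + m)); trivial.
    + now rewrite Ev.
    + intros j Hj Nj. now apply G.
    + apply (IH _ true). now left.
    + intro H. apply (acc_inc _ _ _ _ _ HI). unfold counts at 2. now rewrite Ev.
  - destruct Hr as [<- | Hr]; [| now apply (handshake_faithful v q i q' r m)].
    cbn [r_comp r_pre r_pop r_alts r_guard Nat.b2n] in *.
    apply (start_faithful v i q q' m); trivial.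
    + now rewrite Ev.
    + intros j Hj Nj. now apply G.
    + apply (IH _ false). now left.
    + intro H. apply (acc_dec _ _ _ _ _ m HI); trivial. unfold counts. now rewrite Ev.
  - destruct Hr as [<- | []]. cbn [r_comp r_pre r_pop r_alts r_guard Nat.b2n] in *.
    assert (Z : forall j, j < N -> fst (v j) = 0).
    { intros j Hj. destruct (G j) as [G1 _]; cbn; try lia. rewrite G1. cbn.
      unfold upd, idle_guard. cases. }
    apply (control_faithful v q); trivial; [now rewrite Ev |].
    apply (acc_zero _ _ _ _ _ HI).
    + destruct (G i) as [_ G2]; cbn; try lia. apply G2. cbn. now rewrite upd_same.
    + destruct (IH q' false) as [H _]; [now left |].
      rewrite counts_same, upd_same in H by (now rewrite Ev).
      apply H. intros j Hj _. rewrite upd_other by lia. auto.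
  - destruct Hr as [<- | []]. cbn [r_comp r_pre r_pop r_alts r_guard Nat.b2n] in *.
    assert (Z : forall j, j < N -> fst (v j) = 0).
    { intros j Hj. destruct (G j) as [G1 _]; cbn; try lia. rewrite G1. cbn.
      unfold idle_guard. cases. }
    assert (H : forall p, In (p, false) [(q1, false); (q2, false)] -> accepts I p (counts v)).
    { intros p Hp. destruct (IH p false Hp) as [H _].
      rewrite counts_same, upd_same in H by (now rewrite Ev).
      apply H. intros j Hj _. rewrite upd_other by lia. auto. }
    apply (control_faithful v q); trivial; [now rewrite Ev |].
    apply (acc_fork _ _ _ _ _ HI); apply H; cbn; auto.
  - destruct Hr as [<- | []]. cbn [r_comp r_pre r_pop r_alts r_guard Nat.b2n] in *.
    apply (control_faithful v q); [| now rewrite Ev | now apply acc_halt].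
    intros j Hj. destruct (G j) as [G1 _]; cbn; try lia. rewrite G1. cbn.
    unfold idle_guard. cases.
Qed.

Lemma rules_comp r : In r R -> r_comp r < S N.
Proof.
  intro HR. apply in_flat_map in HR as (x & HI & Hr). pose proof (regs _ HI) as Hi.
  destruct x; cbn in *; intuition (subst; cbn; lia).
Qed.

End Compile.

(** * Regular programs with tests *)

Inductive prog :=
| PInc (i : nat)
| PDec (i : nat)
| PZero (i : nat)
| PSeq (a b : prog)
| PAlt (a b : prog)
| PStar (a : prog)
| PTest (a : prog).

Inductive run : prog -> (nat -> nat) -> (nat -> nat) -> Prop :=
| run_inc i n : run (PInc i) n (upd n i (S (n i)))
| run_dec i n m : n i = S m -> run (PDec i) n (upd n i m)
| run_zero i n : n i = 0 -> run (PZero i) n n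
| run_seq a b n n' n'' : run a n n' -> run b n' n'' -> run (PSeq a b) n n''
| run_altl a b n n' : run a n n' -> run (PAlt a b) n n'
| run_altr a b n n' : run b n n' -> run (PAlt a b) n n'
| run_star0 a n : run (PStar a) n n
| run_starS a n n' n'' : run a n n' -> run (PStar a) n' n'' -> run (PStar a) n n''
| run_test a n n' : run a n n' -> run (PTest a) n n.

Fixpoint runs (k : list prog) (n : nat -> nat) : Prop :=
  match k with [] => True | a :: k => exists n', run a n n' /\ runs k n' end.

Fixpoint code (a : prog) : nat :=
  match a with
  | PInc i => to_nat (0, i)
  | PDec i => to_nat (1, i)
  | PZero i => to_nat (2, i)
  | PSeq a b => to_nat (3, to_nat (code a, code b))
  | PAlt a b => to_nat (4, to_nat (code a, code b))
  | PStar a => to_nat (5, code a)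
  | PTest a => to_nat (6, code a)
  end.

Fixpoint codes (k : list prog) : nat :=
  match k with [] => 0 | a :: k => S (to_nat (code a, codes k)) end.

Lemma to_nat_inj p q : to_nat p = to_nat q -> p = q.
Proof. intro H. apply (f_equal of_nat) in H. now rewrite !cancel_of_to in H. Qed.

Opaque to_nat.

Lemma code_inj a b : code a = code b -> a = b.
Proof.
  revert b. induction a; intros []; cbn; intro H; apply to_nat_inj in H;
    injection H as H; try discriminate; try (apply to_nat_inj in H; injection H as H H');
    f_equal; auto.
Qed.

Lemma codes_inj k l : codes k = codes l -> k = l.
Proof.
  revert l. induction k as [| a k IH]; intros [| b l]; cbn; intro H; try discriminate; trivial.
  apply Nat.succ_inj, to_nat_inj in H. injection H as H1 H2.
  f_equal; [now apply code_inj | auto].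
Qed.

Opaque codes.

(* The control states are the lists of programs still to be run. *)
Definition state_instrs (k : list prog) : list instr :=
  match k with
  | [] => [IHalt (codes [])]
  | PInc i :: k' => [IInc (codes k) i (codes k')]
  | PDec i :: k' => [IDec (codes k) i (codes k')]
  | PZero i :: k' => [IZero (codes k) i (codes k')]
  | PSeq a b :: k' => [IFork (codes k) (codes (a :: b :: k')) (codes (a :: b :: k'))]
  | PAlt a b :: k' =>
      [IFork (codes k) (codes (a :: k')) (codes (a :: k'));
       IFork (codes k) (codes (b :: k')) (codes (b :: k'))]
  | PStar a :: k' =>
      [IFork (codes k) (codes k') (codes k');
       IFork (codes k) (codes (a :: k)) (codes (a :: k))]
  | PTest a :: k' => [IFork (codes k) (codes [a]) (codes k')]
  end.

(** Finitely many continuations suffice: the body of a loop is followed by the loop itself, and a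
    test starts with nothing to follow. *)
Fixpoint reach (a : prog) (k : list prog) : list (list prog) :=
  (a :: k) ::
  match a with
  | PInc _ | PDec _ | PZero _ => []
  | PSeq a b => reach a (b :: k) ++ reach b k
  | PAlt a b => reach a k ++ reach b k
  | PStar b => reach b (a :: k)
  | PTest b => reach b []
  end.

Definition prog_instrs (a : prog) : list instr :=
  flat_map state_instrs ([] :: reach a []).

Fixpoint below (N : nat) (a : prog) : Prop :=
  match a with
  | PInc i | PDec i | PZero i => i < N
  | PSeq a b | PAlt a b => below N a /\ below N b
  | PStar a | PTest a => below N a
  end.

(** A fork with two equal branches is a jump; only a test forks into different branches, one of
    which is abandoned once the tested program has finished. *)
Lemma state_sound I q n :
  (forall x, In x I -> exists k, In x (state_instrs k)) ->
  accepts I q n -> forall k, q = codes k -> runs k n.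
Proof.
  intro HI. induction 1 as [q i q' n H _ IH | q i q' n m H E _ IH | q i q' n H E _ IH
                 | q q1 q2 n H _ IH1 _ IH2 | q n H]; intros k ->;
    destruct (HI _ H) as [k' Hk];
    destruct k' as [| [] k']; cbn [state_instrs In] in Hk;
    repeat match goal with
    | H : _ \/ _ |- _ => destruct H as [H | H]
    end; try contradiction; try discriminate; injection Hk; intros; subst;
    match goal with H : codes _ = codes k |- _ => apply codes_inj in H; subst k end;
    try specialize (IH _ eq_refl); try specialize (IH1 _ eq_refl); try specialize (IH2 _ eq_refl);
    cbn [runs] in *; trivial.
  - eauto using run_inc.
  - eauto using run_dec.
  - eauto using run_zero.
  - destruct IH1 as (n' & H1 & n'' & H2 & H3). eauto using run_seq.
  - destruct IH1 as (n' & H1 & H2). eauto using run_altl.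
  - destruct IH1 as (n' & H1 & H2). eauto using run_altr.
  - eauto using run_star0.
  - destruct IH1 as (n' & H1 & n'' & H2 & H3). eauto using run_starS.
  - destruct IH1 as (n' & H1 & _). eauto using run_test.
Qed.

Lemma state_complete I a n n' : run a n n' ->
  In (IHalt (codes [])) I ->
  forall k, incl (flat_map state_instrs (reach a k)) I ->
  accepts I (codes k) n' -> accepts I (codes (a :: k)) n.
Proof.
  intros H Halt. induction H; intros k HI A; cbn [reach flat_map] in HI;
    rewrite ?flat_map_app in HI;
    apply incl_app_inv in HI as [J0 J1]; cbn [state_instrs] in J0.
  - eapply acc_inc; [apply J0; now left | trivial].
  - eapply acc_dec; [apply J0; now left | eassumption | trivial].
  - eapply acc_zero; [apply J0; now left | trivial..].
  - apply incl_app_inv in J1 as [J1 J2].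
    eapply acc_fork; [apply J0; now left | |]; apply IHrun1; auto.
  - apply incl_app_inv in J1 as [J1 J2].
    eapply acc_fork; [apply J0; now left | |]; apply IHrun; auto.
  - apply incl_app_inv in J1 as [J1 J2].
    eapply acc_fork; [apply J0; right; now left | |]; apply IHrun; auto.
  - eapply acc_fork; [apply J0; now left | |]; auto.
  - eapply acc_fork; [apply J0; right; now left | |]; apply IHrun1; auto;
      apply IHrun2; auto; cbn [reach flat_map]; apply incl_app; trivial.
  - eapply acc_fork; [apply J0; now left | apply IHrun | trivial]; auto.
    now apply acc_halt.
Qed.

Lemma prog_accepts a n : accepts (prog_instrs a) (codes [a]) n <-> exists n', run a n n'.
Proof.
  split.
  - intro H. assert (G : runs [a] n).
    { apply (state_sound _ _ _) with (2 := H); trivial. intros x Hx. apply in_flat_map in Hx as (k & _ & Hk). eauto. }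
    destruct G as (n' & G & _). eauto.
  - intros [n' H]. eapply state_complete; eauto.
    + now left.
    + intros x Hx. apply in_or_app. now right.
    + apply acc_halt. now left.
Qed.

Lemma state_instrs_below N k x : 0 < N ->
  (forall a, In a k -> below N a) -> In x (state_instrs k) -> instr_reg x < N.
Proof.
  intros HN HB Hx.
  destruct k as [| [] k]; cbn in Hx;
    try (specialize (HB _ (or_introl eq_refl)); cbn in HB);
    intuition (subst; cbn; trivial).
Qed.

Lemma reach_below N a : forall k, below N a -> (forall b, In b k -> below N b) ->
  forall l, In l (reach a k) -> forall b, In b l -> below N b.
Proof.
  induction a as [i | i | i | a IHa b IHb | a IHa b IHb | a IHa | a IHa];
    intros k Ha Hk l Hl; cbn [reach] in Hl;
    (destruct Hl as [<- | Hl]; [intros c [<- | Hc]; auto |]); cbn in Ha; try contradiction;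
    try (apply in_app_iff in Hl as [Hl | Hl]);
    match goal with
    | IH : context [reach ?a _], Hl : In l (reach ?a _) |- _ => apply (IH _) with (3 := Hl)
    end; try tauto; trivial;
    intros c Hc; cbn [In] in Hc; intuition (subst; cbn; auto).
Qed.

(** * Reduction of program termination to provability *)

Definition template (N : nat) (a : prog) : fm :=
  machine_fm (flat_map (instr_rules N) (prog_instrs a)) (S N)
    (fun j => if j =? N then codes [a] else 0).

Definition input (m : nat) : nat -> nat := upd (fun _ => 0) 0 m.

Lemma prov_mono full e c full' e' c' x d :
  (full = true -> full' = true) -> (e = true -> e' = true) -> (c = true -> c' = true) ->
  prov full e c x d -> prov full' e' c' x d.
Proof.
  intros Hf He Hc. induction 1;
    [ eapply ax_id | eapply ax_one | eapply ax_zero | eapply ax_nn1 | eapply ax_nn2 |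
      eapply ax_cp1 | eapply ax_cp2 | eapply ax_f1 | eapply ax_f2 | eapply r_cut |
      eapply r_oneL | eapply r_zeroR | eapply r_ldivL | eapply r_ldivR | eapply r_rdivL |
      eapply r_rdivR | eapply r_mulL | eapply r_mulR | eapply r_andL1 | eapply r_andL2 |
      eapply r_andR | eapply r_orL | eapply r_orR1 | eapply r_orR2 | eapply r_bangL |
      eapply r_bangR | eapply r_kw | eapply r_kc | eapply r_ke1 | eapply r_ke2 |
      eapply r_ka1a | eapply r_ka1b | eapply r_ka2a | eapply r_ka2b | eapply r_e | eapply r_c ];
    eauto.
Qed.

(** Soundness is applied after passing to the full calculus, completeness in the calculus without
    (e) and (c); monotonicity places all the others in between. *)
Theorem template_spec N a full e c m : 0 < N -> below N a ->
  (prov full e c (Some (NC (NF (template N a)) (num m))) None <-> exists n', run a (input m) n').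
Proof.
  intros HN HB. rewrite <- prog_accepts.
  assert (HR : forall x, In x (prog_instrs a) -> instr_reg x < N).
  { intros x Hx. apply in_flat_map in Hx as (k & Hk & Hx).
    apply (state_instrs_below _ _ _ HN) with (2 := Hx).
    destruct Hk as [<- | Hk]; [now intros b [] |].
    apply (reach_below N a []); trivial. now intros b []. }
  assert (Ei : init (fun j => if j =? N then codes [a] else 0) m = conf N (codes [a]) (input m)).
  { apply functional_extensionality. intro j. unfold init, conf, input, upd.
    destruct (Nat.eqb_spec j 0), (Nat.eqb_spec j N); trivial; lia. }
  split; intro H.
  - apply (prov_mono full e c true e c), machine_sound in H; trivial; [| lia | now apply rules_comp].
    rewrite Ei in H. apply acc_faithful in H as [H _]; trivial.
    assert (E1 : fst (conf N (codes [a]) (input m) N) = codes [a])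
      by (unfold conf; now rewrite Nat.eqb_refl).
    assert (E2 : counts (conf N (codes [a]) (input m)) = input m).
    { apply functional_extensionality. intro j. unfold counts, conf, input, upd.
      destruct (Nat.eqb_spec j N), (Nat.eqb_spec j 0); trivial; lia. }
    rewrite E1, E2 in H. apply H. intros j Hj _. unfold conf.
    destruct (Nat.eqb_spec j N); trivial; lia.
  - apply (prov_mono false false false); try discriminate.
    apply machine_complete; [now apply rules_comp | lia |].
    rewrite Ei. now apply accepts_acc.
Qed.

(** * Recursive functions *)

(** The diamond modality of propositional dynamic logic. *)
Definition dia (a : prog) (n : nat -> nat) (Q : (nat -> nat) -> Prop) : Prop :=
  exists n', run a n n' /\ Q n'.

Lemma dia_iff a n Q Q' : (forall n', Q n' <-> Q' n') -> (dia a n Q <-> dia a n Q').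
Proof. intro H. split; intros [n' [H1 H2]]; exists n'; split; trivial; now apply H. Qed.

Lemma dia_seq a b n Q : dia (PSeq a b) n Q <-> dia a n (fun n' => dia b n' Q).
Proof.
  split.
  - intros (n' & H & HQ). inversion H; subst. do 2 (eexists; split; eauto).
  - intros (n' & H & n'' & H' & HQ). exists n''. split; trivial. econstructor; eauto.
Qed.

Lemma dia_inc i n Q : dia (PInc i) n Q <-> Q (upd n i (S (n i))).
Proof.
  split.
  - intros (n' & H & HQ). now inversion H; subst.
  - intro H. eexists. split; [apply run_inc | trivial].
Qed.

Lemma dia_dec i n Q : dia (PDec i) n Q <-> exists m, n i = S m /\ Q (upd n i m).
Proof.
  split.
  - intros (n' & H & HQ). inversion H; subst. eauto.
  - intros (m & E & H). eexists. split; [exact (run_dec _ _ _ E) | trivial].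
Qed.

Lemma dia_zero i n Q : dia (PZero i) n Q <-> n i = 0 /\ Q n.
Proof.
  split.
  - intros (n' & H & HQ). now inversion H; subst.
  - intros [E H]. exists n. split; [now apply run_zero | trivial].
Qed.

Lemma dia_test a n Q : dia (PTest a) n Q <-> dia a n (fun _ => True) /\ Q n.
Proof.
  split.
  - intros (n' & H & HQ). inversion H; subst. split; trivial. eexists; eauto.
  - intros [(n' & H & _) HQ]. exists n. split; trivial. eapply run_test; eauto.
Qed.

Lemma dia_star a n Q : dia (PStar a) n Q <-> Q n \/ dia a n (fun n' => dia (PStar a) n' Q).
Proof.
  split.
  - intros (n' & H & HQ). inversion H; subst; [now left | right].
    do 2 (eexists; split; eauto).
  - intros [H | (n' & H & n'' & H' & HQ)].
    + exists n. split; trivial. apply run_star0.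
    + exists n''. split; trivial. eapply run_starS; eauto.
Qed.

Lemma dia_loop a b n Q :
  dia (PSeq (PStar a) b) n Q <-> dia b n Q \/ dia a n (fun n' => dia (PSeq (PStar a) b) n' Q).
Proof.
  rewrite dia_seq, dia_star. apply or_iff_compat_l, dia_iff. intro. now rewrite dia_seq.
Qed.

Lemma upd_upd {A} (n : nat -> A) i x y : upd (upd n i x) i y = upd n i y.
Proof.
  apply functional_extensionality. intro j. unfold upd. now destruct (j =? i).
Qed.

Lemma upd_self {A} (n : nat -> A) i x : n i = x -> upd n i x = n.
Proof.
  intro E. apply functional_extensionality. intro j. unfold upd.
  destruct (Nat.eqb_spec j i); congruence.
Qed.

Lemma upd_comm {A} (n : nat -> A) i j x y : i <> j -> upd (upd n i x) j y = upd (upd n j y) i x.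
Proof.
  intro N. apply functional_extensionality. intro k. unfold upd.
  destruct (Nat.eqb_spec k i), (Nat.eqb_spec k j); congruence.
Qed.

(** * Basic register programs *)

Definition p_guess (i : nat) : prog := PStar (PInc i).
Definition p_eq (i j : nat) : prog :=
  PSeq (PStar (PSeq (PDec i) (PDec j))) (PSeq (PZero i) (PZero j)).
Definition p_clear (i : nat) : prog := PSeq (PStar (PDec i)) (PZero i).
Definition p_move (i j : nat) : prog :=
  PSeq (PStar (PSeq (PDec i) (PInc j))) (PZero i).

(** A guess never lowers the register: from 0 it yields every number, from 1 exactly the positive
    ones. *)
Lemma dia_guess i n Q : dia (p_guess i) n Q <-> exists m, n i <= m /\ Q (upd n i m).
Proof.
  split.
  - intros (n' & H & HQ). enough (E : exists m, n i <= m /\ n' = upd n i m).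
    { destruct E as (m & Hm & ->). eauto. }
    clear HQ. remember (p_guess i) as p. unfold p_guess in Heqp.
    induction H; try discriminate; injection Heqp as ->.
    + exists (n i). split; trivial. now rewrite upd_self.
    + inversion H; subst. destruct IHrun2 as (m & Hm & ->); trivial.
      rewrite upd_same in Hm. exists m. split; [lia | now rewrite upd_upd].
  - intros (m & Hm & HQ). remember (m - n i) as d eqn:Ed.
    revert n Hm HQ Ed. induction d as [| d IH]; intros n Hm HQ Ed; apply dia_star.
    + left. rewrite upd_self in HQ by lia. trivial.
    + right. apply dia_inc. apply IH; rewrite ?upd_same, ?upd_upd; trivial; lia.
Qed.

Lemma dia_eq i j n : i <> j -> (dia (p_eq i j) n (fun _ => True) <-> n i = n j).
Proof.
  intro N. remember (n i) as m eqn:E. revert n E. induction m as [| m IH]; intros n E;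
    unfold p_eq; rewrite dia_loop, !dia_seq, !dia_zero, dia_dec, <- E.
  - split; [intros [H | (m & H & _)]; [symmetry; tauto | discriminate] |]. intros <-. tauto.
  - split.
    + intros [[H _] | (m' & H & K)]; [discriminate |]. injection H as <-.
      rewrite dia_dec in K. destruct K as (m' & E' & K).
      rewrite upd_other in E' by congruence. rewrite E'. f_equal.
      apply IH in K; [now rewrite upd_same in K | now rewrite upd_other, upd_same by congruence].
    + intro E'. right. exists m. split; trivial. apply dia_dec. exists m.
      rewrite upd_other by congruence. split; [congruence |].
      apply IH; [now rewrite upd_other, upd_same by congruence | now rewrite upd_same].
Qed.

Lemma dia_clear i n Q : dia (p_clear i) n Q <-> Q (upd n i 0).
Proof.
  remember (n i) as m eqn:E. revert n E. induction m as [| m IH]; intros n E;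
    unfold p_clear; rewrite dia_loop, dia_zero, dia_dec, <- E.
  - rewrite upd_self by congruence.
    split; [intros [H | (m & H & _)]; [tauto | discriminate] | tauto].
  - assert (K : dia (p_clear i) (upd n i m) Q <-> Q (upd n i 0))
      by (rewrite IH; [now rewrite upd_upd | now rewrite upd_same]).
    rewrite <- K. split.
    + intros [[H _] | (m' & H & K')]; [discriminate |]. now injection H as <-.
    + right. exists m. now split.
Qed.

Lemma dia_move i j n Q : i <> j ->
  (dia (p_move i j) n Q <-> Q (upd (upd n j (n j + n i)) i 0)).
Proof.
  intro N. remember (n i) as m eqn:E. revert n E. induction m as [| m IH]; intros n E;
    unfold p_move; rewrite dia_loop, dia_zero, dia_seq, dia_dec, <- E.
  - rewrite Nat.add_0_r, (upd_self n j), upd_self by congruence.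
    split; [intros [H | (m & H & _)]; [tauto | discriminate] | tauto].
  - set (n' := upd (upd n i m) j (S (n j))).
    assert (K : dia (p_move i j) n' Q <-> Q (upd (upd n j (n j + S m)) i 0)).
    { unfold n'. rewrite IH by now rewrite upd_other, upd_same by congruence.
      rewrite upd_same, upd_upd, (upd_comm _ i j), upd_upd by trivial.
      now replace (S (n j) + m) with (n j + S m) by lia. }
    rewrite <- K. split.
    + intros [[H _] | (m' & H & K')]; [discriminate |]. injection H as <-.
      rewrite dia_inc, upd_other in K' by congruence. exact K'.
    + right. exists m. split; trivial. rewrite dia_inc, upd_other by congruence. trivial.
Qed.

Fixpoint guesses (ws : list nat) : prog :=
  match ws with [] => PZero 1 | w :: ws => PSeq (p_guess w) (guesses ws) end.

Fixpoint tests (ps : list (nat -> prog)) (w : nat) : prog :=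
  match ps with [] => PZero 1 | p :: ps => PSeq (PTest (p w)) (tests ps (S w)) end.

(* [verify f rho o k] can terminate iff the value of [f] at the registers [rho] is in register [o].
   It destroys its registers, which is harmless because every call is the last action of its branch.
   Register 1 and those from [k] on contain 0. *)
Fixpoint verify (f : recf) (rho : list nat) (o k : nat) : prog :=
  match f with
  | RZ => PZero o
  | RS => PSeq (PDec o) (p_eq (nth 0 rho 1) o)
  | RP i => p_eq (nth i rho 1) o
  | RC f gs =>
      let k' := k + length gs in
      PSeq (guesses (seq k (length gs)))
        (PSeq (tests (map (fun g w => verify g rho w k') gs) k)
           (verify f (seq k (length gs)) o k'))
  | RR f g =>
      match rho with
      | [] => PSeq (PInc k) (PZero k)
      | x :: rho =>
          PSeq (PStar (PSeq (PDec x) (PSeq (p_guess k)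
                  (PSeq (PTest (verify g (x :: k :: rho) o (S k)))
                     (PSeq (p_clear o) (p_move k o))))))
            (PSeq (PZero x) (verify f rho o k))
      end
  | RM f =>
      PSeq (PTest (verify f (o :: rho) k (S k)))
        (PSeq (PStar (PSeq (PDec o) (PTest
                 (PSeq (PInc k) (PSeq (p_guess k) (verify f (o :: rho) k (S k)))))))
           (PZero o))
  end.

Section RecfInd.
Variable P : recf -> Prop.
Hypothesis HZ : P RZ.
Hypothesis HS : P RS.
Hypothesis HP : forall i, P (RP i).
Hypothesis HC : forall f gs, P f -> Forall P gs -> P (RC f gs).
Hypothesis HR : forall f g, P f -> P g -> P (RR f g).
Hypothesis HM : forall f, P f -> P (RM f).

Fixpoint recf_nested_ind (f : recf) : P f :=
  match f with
  | RZ => HZ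
  | RS => HS
  | RP i => HP i
  | RC f gs => HC f gs (recf_nested_ind f)
      ((fix all (gs : list recf) : Forall P gs :=
          match gs with
          | [] => Forall_nil P
          | g :: gs => Forall_cons g (recf_nested_ind g) (all gs)
          end) gs)
  | RR f g => HR f g (recf_nested_ind f) (recf_nested_ind g)
  | RM f => HM f (recf_nested_ind f)
  end.
End RecfInd.

Lemma evalr_functional f v y y' : evalr f v y -> evalr f v y' -> y = y'.
Proof.
  revert v y y'. induction f as [| | i | f gs IHf IHgs | f g IHf IHg | f IHf]
    using recf_nested_ind; intros v y y' H H'.
  - inversion H; inversion H'; congruence.
  - inversion H; inversion H'; congruence.
  - inversion H; inversion H'; congruence.
  - inversion H as [| | | ? ? ? ws ? F1 E1 | | |]; inversion H' as [| | | ? ? ? ws' ? F2 E2 | | |]; subst.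
    assert (ws = ws'); [| subst; eauto].
    clear H H' E1 E2 IHf. revert ws ws' F1 F2.
    induction IHgs; intros ws ws' F1 F2; inversion F1; inversion F2; subst; f_equal; eauto.
  - destruct v as [| n v]; [inversion H |]. revert y y' H H'.
    induction n as [| n IH]; intros y y' H H'; inversion H; inversion H'; subst; eauto.
    match goal with H1 : evalr (RR f g) _ ?z, H2 : evalr (RR f g) _ ?z' |- _ =>
      assert (z = z') by eauto; subst end. eauto.
  - inversion H as [| | | | | | ? ? ? E1 L1]; inversion H' as [| | | | | | ? ? ? E2 L2]; subst.
    (* If two results of a minimisation differed, then at the smaller one [f] would have both the
       value 0 and a positive value. *)
    destruct (lt_eq_lt_dec y y') as [[L | E] | L]; trivial.
    + destruct (L2 _ L) as [k Hk]. specialize (IHf _ _ _ E1 Hk). discriminate.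
    + destruct (L1 _ L) as [k Hk]. specialize (IHf _ _ _ E2 Hk). discriminate.
Qed.

Lemma map_upd (n : nat -> nat) i x l : ~ In i l -> map (upd n i x) l = map n l.
Proof.
  intro H. apply map_ext_in. intros j Hj. apply upd_other. now intros ->.
Qed.

Lemma dia_guesses ws n Q : n 1 = 0 -> ~ In 1 ws ->
  (dia (guesses ws) n Q <->
   exists n', (forall j, ~ In j ws -> n' j = n j) /\ (forall j, In j ws -> n j <= n' j) /\ Q n').
Proof.
  revert n. induction ws as [| w ws IH]; intros n H1 HI; cbn [guesses].
  - rewrite dia_zero. split.
    + intros [_ H]. exists n. split; trivial. now split.
    + intros (n' & H & _ & HQ). split; trivial.
      replace n with n'; trivial. apply functional_extensionality. intro j. now apply H.
  - assert (w <> 1 /\ ~ In 1 ws) as [Hw HI'] by (split; intro; apply HI; cbn; auto).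
    rewrite dia_seq, dia_guess. split.
    + intros (m & Hm & H). apply IH in H as (n' & A & B & HQ); trivial.
      2: now rewrite upd_other by congruence.
      exists n'. split; [| split]; trivial.
      * intros j Hj. rewrite A by (intro; apply Hj; now right).
        apply upd_other. intros ->. apply Hj. now left.
      * intros j Hj. destruct (Nat.eq_dec j w) as [-> | Nj].
        -- destruct (in_dec Nat.eq_dec w ws) as [I | I].
           ++ specialize (B w I). rewrite upd_same in B. lia.
           ++ rewrite A, upd_same by trivial. lia.
        -- destruct Hj as [-> | Hj]; [congruence |].
           specialize (B j Hj). now rewrite upd_other in B.
    + intros (n' & A & B & HQ). exists (n' w). split; [apply B; now left |].
      apply IH; trivial; [now rewrite upd_other by congruence |].
      exists n'. split; [| split]; trivial.
      * intros j Hj. unfold upd. destruct (Nat.eqb_spec j w) as [-> | Nj]; trivial.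
        apply A. now intros [-> | H].
      * intros j Hj. unfold upd. destruct (Nat.eqb_spec j w) as [-> | Nj]; trivial.
        apply B. now right.
Qed.

(** * Correctness of the verification programs *)

Definition layout (rho : list nat) (o k : nat) : Prop :=
  NoDup (1 :: o :: rho) /\ forall x, In x (1 :: o :: rho) -> x < k.

Definition blank (n : nat -> nat) (k : nat) : Prop := n 1 = 0 /\ forall j, k <= j -> n j = 0.

Definition verifies (f : recf) : Prop :=
  forall rho o k n, layout rho o k -> blank n k ->
    (dia (verify f rho o k) n (fun _ => True) <-> evalr f (map n rho) (n o)).

(** Register 1 constantly holds 0 and so stands for the default value of a missing argument. *)
Lemma nth_register (n : nat -> nat) i rho : n 1 = 0 -> nth i (map n rho) 0 = n (nth i rho 1).
Proof. intro H. transitivity (nth i (map n rho) (n 1)); [now rewrite H | apply map_nth]. Qed.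

Lemma nth_layout rho o k i : layout rho o k -> nth i rho 1 <> o.
Proof.
  intros [H _]. apply NoDup_cons_iff in H as [H1 H]. apply NoDup_cons_iff in H as [H2 _].
  destruct (nth_in_or_default i rho 1) as [I | ->].
  - intros E. congruence.
  - intros <-. apply H1. now left.
Qed.

Lemma verifies_proj i : verifies (RP i).
Proof.
  intros rho o k n L [B _]. cbn [verify]. rewrite dia_eq by (eapply nth_layout, L).
  rewrite <- nth_register by trivial. split.
  - intros <-. constructor.
  - intro H. now inversion H.
Qed.

Lemma verifies_zero : verifies RZ.
Proof.
  intros rho o k n L B. cbn [verify]. rewrite dia_zero. split.
  - intros [-> _]. constructor.
  - intro H. now inversion H.
Qed.

Lemma verifies_succ : verifies RS.
Proof.
  intros rho o k n L [B _]. cbn [verify]. rewrite dia_seq, dia_dec.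
  pose proof (nth_layout _ _ _ 0 L) as N.
  assert (E : hd 0 (map n rho) = n (nth 0 rho 1))
    by (rewrite <- nth_register by trivial; now destruct rho).
  split.
  - intros (m & Em & H). apply dia_eq in H; trivial. rewrite upd_same, upd_other in H by trivial.
    rewrite Em, <- H, <- E. constructor.
  - intro H. inversion H as [| ? Hv | | | | |]; subst. exists (hd 0 (map n rho)). split; [congruence |].
    apply dia_eq; trivial. now rewrite upd_same, upd_other by trivial.
Qed.

Lemma layout_out rho o o' k k' : layout rho o k -> k <= o' < k' -> layout rho o' k'.
Proof.
  intros [H H'] L. split.
  - apply NoDup_cons_iff in H as [H1 H2]; apply NoDup_cons_iff in H2 as [H3 H4].
    constructor.
    + intros [-> | I]; [specialize (H' 1); cbn in H'; lia | apply H1; now right].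
    + constructor; trivial. intro I. specialize (H' o'); cbn in H'. intuition lia.
  - intros x [<- | [<- | I]]; [specialize (H' 1) | lia | specialize (H' x)]; cbn in H'; intuition lia.
Qed.

Lemma layout_out_cons rho o o' k k' : layout rho o k -> k <= o' < k' -> layout (o :: rho) o' k'.
Proof.
  intros [H H'] L. split.
  - apply NoDup_cons_iff in H as [H1 H2]. constructor.
    + intros [-> | I]; [specialize (H' 1); cbn in H'; lia | now apply H1].
    + constructor; trivial. intro I. specialize (H' o' (or_intror I)). lia.
  - intros x [<- | [<- | I]]; [specialize (H' 1 (or_introl eq_refl)); lia | lia |].
    specialize (H' x (or_intror I)). lia.
Qed.

Lemma layout_seq rho o k l : layout rho o k -> layout (seq k l) o (k + l).
Proof.
  intros [H H']. split.
  - apply NoDup_cons_iff in H as [H1 H2]. constructor.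
    + intros [-> | I]; [apply H1; now left | apply in_seq in I; specialize (H' 1 (or_introl eq_refl)); lia].
    + constructor; [| apply seq_NoDup]. intro I. apply in_seq in I.
      specialize (H' o (or_intror (or_introl eq_refl))). lia.
  - intros x [<- | [<- | I]];
      [specialize (H' 1 (or_introl eq_refl)); lia
      | specialize (H' o (or_intror (or_introl eq_refl))); lia | apply in_seq in I; lia].
Qed.

Lemma layout_prim x rho o k : layout (x :: rho) o k -> layout (x :: k :: rho) o (S k).
Proof.
  intros [H H']. split.
  - apply NoDup_cons_iff in H as [H1 H2]; apply NoDup_cons_iff in H2 as [H3 H4];
      apply NoDup_cons_iff in H4 as [H5 H6].
    assert (Hk : ~ In k (1 :: o :: x :: rho)) by (intro I; specialize (H' k I); lia).
    cbn in *. repeat constructor; cbn; intuition congruence.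
  - intros y Hy. cbn in *. destruct (Nat.eq_dec y k) as [-> | N]; [lia |].
    specialize (H' y). intuition lia.
Qed.

(** Register [k] still contains 0, so the first test says that [f] vanishes at the claimed minimum.
    The loop then counts [o] down and tests at each smaller argument that [f] has a positive value,
    guessed from 1 upwards. *)
Lemma verifies_min f : verifies f -> verifies (RM f).
Proof.
  unfold verifies. intros IH rho o k n L B.
  assert (Hk : o < k /\ 1 < k /\ o <> 1 /\ ~ In o rho /\ ~ In k (1 :: o :: rho)).
  { destruct L as [H H']. apply NoDup_cons_iff in H as [H1 H2]; apply NoDup_cons_iff in H2 as [H3 H4].
    split; [| split; [| split; [| split]]]; trivial.
    - apply H'. cbn; auto.
    - apply H'. cbn; auto.
    - intros ->. apply H1. now left.
    - intro I. specialize (H' k I). lia. }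
  destruct Hk as (Ho & H1 & Ho1 & Hr & Hk).
  assert (Hkr : ~ In k rho) by (intro; apply Hk; cbn; auto).
  assert (L' : layout (o :: rho) k (S k)) by (apply layout_out_cons with (1 := L); lia).
  assert (Body : forall n, blank n k ->
    (dia (PSeq (PInc k) (PSeq (p_guess k) (verify f (o :: rho) k (S k)))) n (fun _ => True) <->
     exists z, evalr f (n o :: map n rho) (S z))).
  { clear n B. intros n [B1 B2]. rewrite dia_seq, dia_inc, dia_seq, dia_guess, upd_same, B2 by lia.
    assert (E : forall m, dia (verify f (o :: rho) k (S k)) (upd (upd n k 1) k m) (fun _ => True)
                <-> evalr f (n o :: map n rho) m).
    { intro m. rewrite upd_upd, IH; trivial.
      - cbn [map]. now rewrite upd_same, upd_other, map_upd by lia || trivial.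
      - split; [now rewrite upd_other by lia |]. intros j Hj. rewrite upd_other by lia. apply B2. lia. }
    split.
    - intros (m & Hm & H). apply E in H. destruct m; [lia | eauto].
    - intros [z Hz]. exists (S z). split; [lia | now apply E]. }
  cbn [verify]. rewrite dia_seq, dia_test.
  rewrite IH; [| trivial | destruct B as [B1 B2]; split; trivial; intros; apply B2; lia].
  cbn [map]. replace (n k) with 0 by (symmetry; now apply B).
  assert (Loop : forall y n, n o = y -> blank n k ->
    (dia (PSeq (PStar (PSeq (PDec o) (PTest
                 (PSeq (PInc k) (PSeq (p_guess k) (verify f (o :: rho) k (S k)))))))
           (PZero o)) n (fun _ => True) <->
     forall m, m < y -> exists z, evalr f (m :: map n rho) (S z))).
  { clear n B. induction y as [| y IHy]; intros n E B;
      rewrite dia_loop, dia_zero, dia_seq, dia_dec, E.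
    - split; [lia | tauto].
    - assert (B' : blank (upd n o y) k).
      { destruct B as [B1 B2]. split; [now rewrite upd_other by congruence |].
        intros j Hj. rewrite upd_other by lia. auto. }
      assert (K : dia (PTest (PSeq (PInc k) (PSeq (p_guess k) (verify f (o :: rho) k (S k)))))
         (upd n o y)
         (fun n' => dia (PSeq (PStar (PSeq (PDec o) (PTest
                 (PSeq (PInc k) (PSeq (p_guess k) (verify f (o :: rho) k (S k)))))))
           (PZero o)) n' (fun _ => True)) <->
         forall m, m < S y -> exists z, evalr f (m :: map n rho) (S z)).
      { rewrite dia_test, Body, IHy by (trivial; now rewrite upd_same).
        rewrite upd_same, map_upd by trivial. split.
        - intros [H H'] m Hm. destruct (Nat.eq_dec m y) as [-> | N]; trivial. apply H'. lia.
        - intro H. split; auto. }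
      rewrite <- K. split.
      + intros [[H _] | (m & H & H')]; [discriminate |]. now injection H as <-.
      + right. now exists y. }
  rewrite (Loop (n o)) by trivial. split.
  - intros [H H']. now constructor.
  - intro H. inversion H; subst. now split.
Qed.

(** The recursion is checked from the top down: each round guesses the preceding value in [k], tests
    [g] against [o], and then makes the guess the new content of [o]. At argument 0 the base
    function [f] is verified. *)
Lemma verifies_prim f g : verifies f -> verifies g -> verifies (RR f g).
Proof.
  unfold verifies. intros IHf IHg rho o k n L B. destruct rho as [| x rho]; cbn [verify].
  (* Primitive recursion has no value on the empty argument list; accordingly the program increments
     [k] and then fails its zero test. *)
  { rewrite dia_seq, dia_inc, dia_zero, upd_same. split; [intros [H _]; discriminate |].
    intro H. inversion H. }
  pose proof (layout_prim _ _ _ _ L) as L'.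
  assert (Hk : x <> 1 /\ x <> o /\ x < k /\ o < k /\ 1 < k /\ o <> 1 /\
               ~ In x rho /\ ~ In o rho /\ ~ In k rho /\ NoDup (1 :: o :: rho)).
  { destruct L as [H H']. apply NoDup_cons_iff in H as [H1 H2]; apply NoDup_cons_iff in H2 as [H3 H4];
      apply NoDup_cons_iff in H4 as [H5 H6]. cbn in *.
    assert (~ In k rho) by (intro I; specialize (H' k); intuition lia).
    intuition. constructor; cbn; intuition. now constructor; intuition. }
  destruct Hk as (Hx1 & Hxo & Hx & Ho & H1 & Ho1 & Hxr & Hor & Hkr & ND).
  assert (Lf : layout rho o k).
  { split; trivial. intros y Hy. apply L. cbn in *. tauto. }
  clear L.
  set (body := PSeq (PDec x) (PSeq (p_guess k)
                  (PSeq (PTest (verify g (x :: k :: rho) o (S k)))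
                     (PSeq (p_clear o) (p_move k o))))).
  assert (Body : forall n Q m, blank n k -> n x = S m ->
    (dia body n Q <-> exists z, evalr g (m :: z :: map n rho) (n o) /\ Q (upd (upd n x m) o z))).
  { clear n B. intros n Q m [B1 B2] E. unfold body. rewrite dia_seq, dia_dec, E.
    assert (K : forall z,
      dia (PSeq (PTest (verify g (x :: k :: rho) o (S k))) (PSeq (p_clear o) (p_move k o)))
         (upd (upd n x m) k z) Q <->
      evalr g (m :: z :: map n rho) (n o) /\ Q (upd (upd n x m) o z)).
    { intro z. rewrite dia_seq, dia_test, dia_seq, dia_clear, dia_move, IHg by (lia || trivial ||
        (split; [now rewrite !upd_other by lia | intros j Hj; rewrite !upd_other by lia; apply B2; lia])).
      apply Morphisms_Prop.and_iff_morphism.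
      - cbn [map]. rewrite upd_same, (upd_other _ k z x), upd_same, !map_upd by (lia || trivial).
        now rewrite !upd_other by lia.
      - replace (upd _ k 0) with (upd (upd n x m) o z); [reflexivity |].
        apply functional_extensionality. intro j. unfold upd.
        destruct (Nat.eqb_spec j k) as [-> | Nk].
        + destruct (Nat.eqb_spec k o), (Nat.eqb_spec k x); try lia. apply B2. lia.
        + destruct (Nat.eqb_spec j o); trivial.
          destruct (Nat.eqb_spec o o), (Nat.eqb_spec k o), (Nat.eqb_spec k k); lia. }
    split.
    - intros (m' & Em & H). injection Em as <-. rewrite dia_seq, dia_guess in H.
      destruct H as (z & _ & H). apply K in H. eauto.
    - intros (z & H). exists m. split; trivial. rewrite dia_seq, dia_guess. exists z.
      split; [rewrite upd_other, B2; lia | now apply K]. }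
  enough (Loop : forall y n, n x = y -> blank n k ->
    (dia (PSeq (PStar body) (PSeq (PZero x) (verify f rho o k))) n (fun _ => True) <->
     evalr (RR f g) (y :: map n rho) (n o))) by (now apply Loop).
  clear n B. induction y as [| y IHy]; intros n E B; rewrite dia_loop, dia_seq, dia_zero, E.
  - rewrite IHf by trivial. split.
    + intros [[_ H] | H]; [now constructor |].
      unfold body in H. rewrite dia_seq, dia_dec, E in H. destruct H as (m & H & _). discriminate.
    + intro H. inversion H; subst. auto.
  - rewrite (Body _ _ y) by trivial.
    assert (K : forall z,
      dia (PSeq (PStar body) (PSeq (PZero x) (verify f rho o k))) (upd (upd n x y) o z) (fun _ => True)
      <-> evalr (RR f g) (y :: map n rho) z).
    { intro z. rewrite IHy.
      - now rewrite upd_same, !map_upd by trivial.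
      - now rewrite upd_other, upd_same by lia.
      - destruct B as [B1 B2]. split; [now rewrite !upd_other by lia |].
        intros j Hj. rewrite !upd_other by lia. auto. }
    split.
    + intros [[H _] | (z & Hg & H)]; [discriminate |]. apply K in H.
      econstructor; eassumption.
    + intro H. inversion H; subst. right. exists z. split; trivial. now apply K.
Qed.

Lemma dia_tests gs (V : recf -> nat -> prog) v n Q w : n 1 = 0 ->
  (forall g w', In g gs -> w <= w' < w + length gs ->
     (dia (V g w') n (fun _ => True) <-> evalr g v (n w'))) ->
  (dia (tests (map V gs) w) n Q <->
   Forall2 (fun g y => evalr g v y) gs (map n (seq w (length gs))) /\ Q n).
Proof.
  intro B. revert w. induction gs as [| g gs IH]; intros w H; cbn [map tests length seq].
  - rewrite dia_zero. intuition.
  - rewrite dia_seq, dia_test, IH, (H g w); cbn; auto; try lia.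
    + split.
      * intros (? & ? & ?). split; trivial. now constructor.
      * intros [F ?]. inversion F; subst. auto.
    + intros g' w' Hg Hw. apply H; [now right | cbn; lia].
Qed.

Lemma verifies_comp f gs : verifies f -> Forall verifies gs -> verifies (RC f gs).
Proof.
  unfold verifies at 1. intros IHf IHgs rho o k n L [B1 B2]. cbn [verify].
  set (l := length gs).
  assert (H1 : 1 < k) by (apply L; now left).
  assert (Ho : o < k) by (apply L; right; now left).
  rewrite dia_seq, dia_guesses by (trivial; rewrite in_seq; lia).
  assert (K : forall n', (forall j, ~ In j (seq k l) -> n' j = n j) ->
    (dia (PSeq (tests (map (fun g w => verify g rho w (k + l)) gs) k)
           (verify f (seq k l) o (k + l))) n' (fun _ => True) <->
     Forall2 (fun g y => evalr g (map n rho) y) gs (map n' (seq k l)) /\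
     evalr f (map n' (seq k l)) (n o))).
  { intros n' A.
    assert (Er : map n' rho = map n rho).
    { apply map_ext_in. intros j Hj. apply A. rewrite in_seq.
      assert (j < k) by (apply L; cbn; auto). lia. }
    assert (B' : blank n' (k + l)).
    { split; [rewrite A; trivial; rewrite in_seq; lia |].
      intros j Hj. rewrite A by (rewrite in_seq; lia). apply B2. lia. }
    rewrite dia_seq, (dia_tests gs (fun g w => verify g rho w (k + l)) (map n rho)).
    - fold l. rewrite IHf; trivial; [| now apply (layout_seq rho)].
      rewrite (A o) by (rewrite in_seq; lia). reflexivity.
    - exact (proj1 B').
    - intros g w' Hg Hw. rewrite Forall_forall in IHgs. rewrite <- Er.
      apply IHgs; trivial. apply layout_out with (1 := L). unfold l. lia. }
  split.
  - intros (n' & A & _ & H). apply K in H as [H H']; trivial. econstructor; eassumption.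
  - intro H. inversion H as [| | | ? ? ? ws ? F E | | |]; subst.
    assert (Hl : length ws = l) by (symmetry; eapply Forall2_length, F).
    (* The right guesses are the intermediate values [ws], stored in the registers from [k] to
       [k + l - 1]; these are blank before, so any values can be guessed. *)
    set (n' := fun j => if ((k <=? j) && (j <? k + l))%bool then nth (j - k) ws 0 else n j).
    assert (Em : map n' (seq k l) = ws).
    { apply nth_ext with (d := 0) (d' := 0); rewrite length_map, length_seq; [now symmetry |].
      intros i Hi. rewrite nth_indep with (d' := n' 0) by (now rewrite length_map, length_seq).
      rewrite map_nth, seq_nth by trivial. unfold n'.
      destruct (Nat.leb_spec k (k + i)), (Nat.ltb_spec (k + i) (k + l)); try lia.
      cbn. f_equal. lia. }
    assert (A : forall j, ~ In j (seq k l) -> n' j = n j).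
    { intros j Hj. rewrite in_seq in Hj. unfold n'.
      destruct (Nat.leb_spec k j), (Nat.ltb_spec j (k + l)); trivial. lia. }
    exists n'. split; [trivial | split].
    + intros j Hj. apply in_seq in Hj. rewrite B2; lia.
    + apply K; trivial. now rewrite Em.
Qed.

Theorem verify_correct f : verifies f.
Proof.
  induction f using recf_nested_ind.
  - apply verifies_zero.
  - apply verifies_succ.
  - apply verifies_proj.
  - now apply verifies_comp.
  - now apply verifies_prim.
  - now apply verifies_min.
Qed.

Lemma below_exists a : exists N, forall N', N <= N' -> below N' a.
Proof.
  induction a as [i | i | i | a [N HN] b [N' HN'] | a [N HN] b [N' HN'] | a [N HN] | a [N HN]];
    cbn; try (exists (S i); lia); try (now exists N);
    exists (N + N'); intros; split; [apply HN | apply HN' | apply HN | apply HN']; lia.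
Qed.

Theorem nonzero_value_template G : exists A, forall full e c m,
  prov full e c (Some (NC (NF A) (num m))) None <-> exists b, evalr G [m] (S b).
Proof.
  (* Register 0 holds the argument, register 1 the constant 0 and register 2 the result; the initial
     increment restricts the guess to nonzero results. *)
  set (a := PSeq (PInc 2) (PSeq (p_guess 2) (verify G [0] 2 3))).
  destruct (below_exists a) as [N HN].
  exists (template (S N) a). intros full e c m.
  rewrite template_spec by (lia || (apply HN; lia)).
  transitivity (dia a (input m) (fun _ => True)).
  { unfold dia. split; intros [n' H]; exists n'; tauto. }
  assert (E : forall b, dia (verify G [0] 2 3) (upd (upd (input m) 2 1) 2 b) (fun _ => True)
                        <-> evalr G [m] b).
  { intro b. pose proof (verify_correct G) as V. unfold verifies in V. rewrite V; [reflexivity | |].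
    - split; [repeat constructor; cbn; intuition lia | cbn; intuition lia].
    - split; [reflexivity |]. intros j Hj. unfold upd, input, upd.
      destruct (Nat.eqb_spec j 2), (Nat.eqb_spec j 0); lia. }
  unfold a. rewrite dia_seq, dia_inc, dia_seq, dia_guess. split.
  - intros (b & Hb & H). apply E in H. rewrite upd_same in Hb. destruct b; [lia | eauto].
  - intros [b H]. exists (S b). rewrite upd_same. split; [cbn; lia | now apply E].
Qed.

(** * Diagonalisation *)

Fixpoint r_const (n : nat) : recf :=
  match n with 0 => RZ | S n => RC RS [r_const n] end.
Definition r_add : recf := RR (RP 0) (RC RS [RP 1]).
Definition r_triangle : recf := RR RZ (RC RS [RC r_add [RP 0; RP 1]]).
Definition r_pair : recf := RC r_add [RC r_triangle [r_add]; RP 1].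

Lemma eval_comp1 f g v x y : evalr g v x -> evalr f [x] y -> evalr (RC f [g]) v y.
Proof. intros H H'. apply ev_c with (ws := [x]); auto. Qed.

Lemma eval_comp2 f g h v x x' y :
  evalr g v x -> evalr h v x' -> evalr f [x; x'] y -> evalr (RC f [g; h]) v y.
Proof. intros H1 H2 H. apply ev_c with (ws := [x; x']); auto. Qed.

Lemma eval_const n v : evalr (r_const n) v n.
Proof. induction n; [constructor | eapply eval_comp1; [eassumption | apply ev_s]]. Qed.

Lemma eval_add a b : evalr r_add [a; b] (a + b).
Proof.
  induction a as [| a IH].
  - apply ev_r0, (ev_p 0).
  - eapply ev_rS; [exact IH |]. eapply eval_comp1; [apply (ev_p 1) | apply ev_s].
Qed.

(** Triangular numbers replace the division in [cpair] by a primitive recursion. *)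
Fixpoint triangle (n : nat) : nat := match n with 0 => 0 | S n => S (n + triangle n) end.

Lemma eval_triangle n : evalr r_triangle [n] (triangle n).
Proof.
  induction n as [| n IH].
  - apply ev_r0, ev_z.
  - eapply ev_rS; [exact IH |].
    apply eval_comp1 with (n + triangle n); [| apply ev_s].
    eapply eval_comp2; [apply (ev_p 0) | apply (ev_p 1) | apply eval_add].
Qed.

Lemma cpair_triangle a b : cpair a b = triangle (a + b) + b.
Proof.
  unfold cpair. f_equal. generalize (a + b). intro n.
  assert (H : n * (n + 1) = triangle n * 2) by (induction n; cbn [triangle]; lia).
  rewrite H. now apply Nat.div_mul.
Qed.

Lemma eval_pair a b : evalr r_pair [a; b] (cpair a b).
Proof.
  rewrite cpair_triangle. eapply eval_comp2; [| apply (ev_p 1) | apply eval_add].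
  eapply eval_comp1; [apply eval_add | apply eval_triangle].
Qed.

Definition r_num : recf :=
  RR (r_const (enc_nstr (num 0)))
    (RC r_pair [r_const 1; RC r_pair [RP 1; r_const (enc_nstr (NF (letv 0)))]]).

Lemma eval_num m : evalr r_num [m] (enc_nstr (num m)).
Proof.
  induction m as [| m IH].
  - apply ev_r0, eval_const.
  - eapply ev_rS; [exact IH |].
    eapply eval_comp2; [apply eval_const | | apply eval_pair].
    eapply eval_comp2; [apply (ev_p 1) | apply eval_const | apply eval_pair].
Qed.

(** The tags 1 and 0 are those of [NC] and [NF], [RS] accounts for the nonempty structure, and the
    last constant encodes the empty stoup. *)
Definition r_diag : recf :=
  RC r_pair
    [ RC RS [RC r_pair [r_const 1; RC r_pair [RC r_pair [r_const 0; RP 0]; r_num]]];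
      r_const 0 ].

Definition diag (A : fm) : str := Some (NC (NF A) (num (enc_fm A))).

Lemma eval_diag A : evalr r_diag [enc_fm A] (enc_seq (diag A) None).
Proof.
  eapply eval_comp2; [| apply eval_const | apply eval_pair].
  apply eval_comp1 with (enc_nstr (NC (NF A) (num (enc_fm A)))); [| apply ev_s].
  eapply eval_comp2; [apply eval_const | | apply eval_pair].
  eapply eval_comp2; [| | apply eval_pair].
  - eapply eval_comp2; [apply eval_const | apply (ev_p 0) | apply eval_pair].
  - apply eval_num.
Qed.

(** By the choice of [A], its diagonal sequent is provable iff the decider answers nonzero on it,
    whereas the answer 0 is the one that stands for provability. *)
Theorem prov_undecidable full e c : ~ seq_decidable (prov full e c).
Proof.
  intros [f Hf].
  destruct (nonzero_value_template (RC f [r_diag])) as [A HA].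
  specialize (HA full e c (enc_fm A)). fold (diag A) in HA.
  destruct (Hf (diag A) None) as (b & Eb & Hb).
  assert (E : evalr (RC f [r_diag]) [enc_fm A] b)
    by (eapply eval_comp1; [apply eval_diag | exact Eb]).
  destruct b as [| b].
  - destruct HA as [HA _]. destruct (HA (proj1 Hb eq_refl)) as [b E'].
    pose proof (evalr_functional _ _ _ _ E E'). discriminate.
  - destruct HA as [_ HA]. enough (S b = 0) by discriminate. apply Hb, HA. eauto.
Qed.

Theorem mainTheorem20 (e c : bool) :
  ~ seq_decidable (prov false e c) /\ ~ seq_decidable (prov true e c).
Proof. split; apply prov_undecidable. Qed.
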